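(* Let $n\ge 2$ be an integer and let $d,e,j,\ell\ge 1$ be integers such that $d+e\le n$, $1\le j\le \ell\le e$ and $j\le d$. Then $$\mathring\mu_n(d|e)_j\ge \frac{n-\ell}{n-e}\cdot\mathring\mu_n(d|\ell)_j.$$
   Context: A subspace of $\mathbb{R}^n$ is rational if it has a basis of vectors with rational coordinates; $\mathfrak{R}_n(e)$ denotes the set of rational subspaces of $\mathbb{R}^n$ of dimension $e$. A subspace $A$ of $\mathbb{R}^n$ is $(e,j)$-irrational if $\dim(A\cap B)<j$ for all $B\in\mathfrak{R}_n(e)$; $\mathfrak{I}_n(d,e)_j$ denotes the set of all $(e,j)$-irrational subspaces of dimension $d$ of $\mathbb{R}^n$. Height: for $B\in\mathfrak{R}_n(e)$, let $\Xi\in\mathbb{Z}^N$, $N=\binom ne$, be a vector of Pl\''ucker coordinates of $B$ which is integral with setwise coprime coordinates; $H(B)=\Vert\Xi\Vert$ (Euclidean norm). Equivalently $H(B)$ is the covolume of $B\cap\mathbb{Z}^n$ in $B$. Proximity: $\mathbb{R}^n$ has its standard Euclidean structure. For nonzero $X,Y\in\mathbb{R}^n$, $\psi(X,Y)=\Vert X\wedge Y\Vert/(\Vert X\Vert\,\Vert Y\Vert)$ is the sine of the angle between $X$ and $Y$. For subspaces $A,B$ of $\mathbb{R}^n$ of dimensions $d,e\ge 1$ and $t=\min(d,e)$, define inductively $\psi_1(A,B)=\min\{\psi(X,Y): X\in A\setminus\{0\},Y\in B\setminus\{0\}\}$, attained at unit vectors $X_1\in A$, $Y_1\in B$; and, given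 $(X_1,Y_1),\dots,(X_j,Y_j)$ with $j<t$, let $A_j$ (resp. $B_j$) be the orthogonal complement of $\mathrm{Span}(X_1,\dots,X_j)$ in $A$ (resp. of $\mathrm{Span}(Y_1,\dots,Y_j)$ in $B$), and $\psi_{j+1}(A,B)=\min\{\psi(X,Y): X\in A_j\setminus\{0\},Y\in B_j\setminus\{0\}\}$, attained at unit vectors $X_{j+1},Y_{j+1}$. (These are the sines of the canonical angles between $A$ and $B$ and do not depend on the choices.) Exponents: let $n\ge 2$, $d,e\in\{1,\dots,n-1\}$ with $d+e\le n$, $j\in\{1,\dots,\min(d,e)\}$. For $A\in\mathfrak{I}_n(d,e)_j$, $\mu_n(A|e)_j\in[0,+\infty]$ is the supremum of all $\beta>0$ such that $\psi_j(A,B)\le H(B)^{-\beta}$ holds for infinitely many $B\in\mathfrak{R}_n(e)$. Set $\mathring\mu_n(d|e)_j=\inf_{A\in\mathfrak{I}_n(d,e)_j}\mu_n(A|e)_j$. *)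

(* Defs.v *)
(* Written over MathComp and MathComp-Analysis. *)
From HB Require Import structures.
From mathcomp Require Import all_boot all_order all_algebra.
From mathcomp Require Import all_classical all_reals all_analysis.

Set Implicit Arguments.
Unset Strict Implicit.
Unset Printing Implicit Defensive.

Import Order.TTheory GRing.Theory Num.Theory.

Local Open Scope classical_set_scope.
Local Open Scope ring_scope.

Section Subspaces.
Context {R : realType} {n : nat}.
Implicit Types A B : {vspace 'rV[R]_n}.

Definition rational_subspace B : Prop :=
  exists b : seq 'rV[rat]_n, basis_of B [seq map_mx ratr v | v <- b].

Definition rational_subspaces (e : nat) : set {vspace 'rV[R]_n} :=
  [set B | rational_subspace B /\ \dim B = e].

Definition ej_irrational (e j : nat) A : Prop :=
  forall B, rational_subspaces e B -> (\dim (A :&: B) < j)%N.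

Definition irrational_subspaces (d e j : nat) : set {vspace 'rV[R]_n} :=
  [set A | \dim A = d /\ ej_irrational e j A].

End Subspaces.

(* The binom(n, e) indices of Pluecker coordinates: the strictly increasing
   maps from {0, ..., e-1} to {0, ..., n-1}. *)
Definition plucker_index (n e : nat) :=
  {f : {ffun 'I_e -> 'I_n} |
    [forall i : 'I_e, forall k : 'I_e, (i < k)%N ==> (f i < f k)%N]}.

Section Height.
Context {R : realType} {n : nat}.
Implicit Types B : {vspace 'rV[R]_n}.

(* For e > 0, every nonzero multiple of a vector of Pluecker coordinates of B
   is again the vector of maximal minors of a basis of B. *)
Definition plucker_coordinates (e : nat) B (xi : plucker_index n e -> R) : Prop :=
  exists2 b : e.-tuple 'rV[R]_n, basis_of B b &
    forall I, xi I = \det (\matrix_(i < e, k < e) tnth b i 0 (val I k)).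

Definition setwise_coprime (e : nat) (Xi : plucker_index n e -> int) : Prop :=
  \big[gcdn/0%N]_I `|Xi I|%N = 1%N.

Definition is_height B (h : R) : Prop :=
  exists Xi : plucker_index n (\dim B) -> int,
    [/\ plucker_coordinates B (fun I => (Xi I)%:~R),
        setwise_coprime Xi &
        h = Num.sqrt (\sum_I (Xi I)%:~R ^+ 2)].

(* For rational B the vector Xi exists and is unique up to sign, so that
   is_height B holds of exactly one h; the default value 0 is used only when
   B is not rational. *)
Definition height B : R := xget 0 [set h | is_height B h].

End Height.

Section Proximity.
Context {R : realType} {n : nat}.
Implicit Types (X Y : 'rV[R]_n) (A B : {vspace 'rV[R]_n}).

(* The norm provided by MathComp-Analysis on 'rV[R]_n is the sup norm, hence
   the Euclidean structure is defined here. *)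
Definition dotv X Y : R := \sum_i X 0 i * Y 0 i.

Definition enorm X : R := Num.sqrt (dotv X X).

Definition wedge_norm X Y : R :=
  Num.sqrt (\sum_(i < n) \sum_(k < n | (i < k)%N)
              (X 0 i * Y 0 k - X 0 k * Y 0 i) ^+ 2).

Definition psi X Y : R := wedge_norm X Y / (enorm X * enorm Y).

Definition ortho_compl (s : seq 'rV[R]_n) A : set 'rV[R]_n :=
  [set X | X \in A /\ forall Z, Z \in span s -> dotv X Z = 0].

Definition min_pair (U V : set 'rV[R]_n) X Y : Prop :=
  [/\ U X /\ enorm X = 1, V Y /\ enorm Y = 1 &
      forall X' Y', U X' -> X' != 0 -> V Y' -> Y' != 0 -> psi X Y <= psi X' Y'].

(* canonical_pairs A B [:: X_1; ...; X_j] [:: Y_1; ...; Y_j] *)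
Inductive canonical_pairs A B : seq 'rV[R]_n -> seq 'rV[R]_n -> Prop :=
| CanonicalNil : canonical_pairs A B [::] [::]
| CanonicalRcons Xs Ys X Y :
    canonical_pairs A B Xs Ys ->
    min_pair (ortho_compl Xs A) (ortho_compl Ys B) X Y ->
    canonical_pairs A B (rcons Xs X) (rcons Ys Y).

Definition is_psi_ (j : nat) A B (s : R) : Prop :=
  exists Xs Ys, [/\ canonical_pairs A B Xs Ys, size Xs = j &
                    s = psi (last 0 Xs) (last 0 Ys)].

(* For 1 <= j <= min(dim A, dim B) exactly one s satisfies is_psi_ j A B s,
   and the default value 0 is not used. *)
Definition psi_ (j : nat) A B : R := xget 0 [set s | is_psi_ j A B s].

End Proximity.

Section Exponents.
Variable R : realType.
Local Open Scope ereal_scope.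

(* The supremum is taken in [0, +oo]: the supremum of the empty set is 0,
   while ereal_sup set0 = -oo. *)
Definition mu (n : nat) (A : {vspace 'rV[R]_n}) (e j : nat) : \bar R :=
  maxe 0 (ereal_sup [set beta%:E | beta in
    [set beta : R | (0 < beta)%R /\
      infinite_set [set B | rational_subspaces e B /\
                            (psi_ j A B <= height B `^ (- beta))%R]]]).

Definition mu_ring (n d e j : nat) : \bar R :=
  ereal_inf [set mu A e j | A in @irrational_subspaces R n d e j].

End Exponents.

(* Main.v *)
(** Fix [A] in the class of [(e, j)]-irrational subspaces; it is also
    [(l, j)]-irrational.  Every rational [C] of dimension [l] lies in a rational
    [B] of dimension [e] with [H(B) <= c H(C)^((n-e)/(n-l))], and
    [psi_j(A, B) <= psi_j(A, C)] by the min-max principle, so good approximations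
    of [A] by subspaces of dimension [l] give good approximations by subspaces of
    dimension [e].  Infinitely many [B] arise: [psi_j(A, B) > 0] by irrationality,
    whereas [psi_j(A, B)] gets arbitrarily small, only finitely many [C] having
    bounded height.

    To go from [C] up by one dimension, let [D] be the largest absolute value of
    the coprime Pluecker coordinates of [C], and let [E] be the basis of [C] whose
    submatrix on the corresponding columns is the identity.  The row vectors [xE],
    with [x] integral, fall into at least [D] classes modulo [Z^n].  All have
    integral coordinates on these columns, so by the pigeonhole principle two of
    them differ by [v + w] with [v] integral and [w <> 0] supported on the [n - l]
    other columns, of sup norm at most [2 D^(-1/(n-l))].  Adjoining [v] to [C]
    amounts to adjoining [w], whence a height of order [D^(1 - 1/(n-l))]. *)
Require Import Defs.
From HB Require Import structures.
From mathcomp Require Import all_boot all_order all_algebra all_fingroup.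
From mathcomp Require Import all_classical all_reals all_analysis.
From mathcomp Require Import ring lra zify.

Set Implicit Arguments.
Unset Strict Implicit.
Unset Printing Implicit Defensive.

Import Order.TTheory GRing.Theory Num.Theory.

Local Open Scope ring_scope.

(** * Minors and row spaces *)

(** Column maps are arbitrary, not only increasing, so that one column can be replaced without
    sorting the others again. *)
Definition minor (R : comNzRingType) e n (f : 'I_e -> 'I_n) (M : 'M[R]_(e, n)) : R :=
  \det (mxsub id f M).

Lemma minor_mulmx (R : comNzRingType) e n (f : 'I_e -> 'I_n) (P : 'M[R]_e) (M : 'M[R]_(e, n)) :
  minor f (P *m M) = \det P * minor f M.
Proof. by rewrite /minor -mulmx_colsub det_mulmx. Qed.

Lemma minor_map (R S : comNzRingType) (h : {rmorphism R -> S}) e n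
    (f : 'I_e -> 'I_n) (M : 'M[R]_(e, n)) :
  minor f (map_mx h M) = h (minor f M).
Proof. by rewrite /minor -map_mxsub det_map_mx. Qed.

Lemma eq_minor (R : comNzRingType) e n (f g : 'I_e -> 'I_n) (M : 'M[R]_(e, n)) :
  f =1 g -> minor f M = minor g M.
Proof. by move=> fg; congr (\det _); apply/matrixP => i k; rewrite !mxE fg. Qed.

Lemma minor_not_injective (R : comNzRingType) e n (f : 'I_e -> 'I_n) (M : 'M[R]_(e, n)) :
  ~~ injectiveb f -> minor f M = 0.
Proof.
case/injectivePn => i [k ik fik]; rewrite /minor -det_tr.
by apply: (determinant_alternate ik) => j; rewrite !mxE fik.
Qed.

Lemma injective_increasing_perm e n (f : 'I_e -> 'I_n) : injective f ->
  exists (I : plucker_index n e) (s : 'S_e), forall i, f i = val I (s i).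
Proof.
move=> fI; pose t := [tuple f i | i < e].
pose t' := [tuple of sort (fun x y : 'I_n => x <= y)%N t].
have /tuple_permP[s ts] : perm_eq t t' by rewrite perm_sym perm_sort.
have ut' : uniq t'.
  by rewrite sort_uniq map_inj_uniq// enum_uniq.
have st' : sorted (fun x y : 'I_n => x < y)%N t'.
  have : sorted (fun x y : 'I_n => x <= y)%N t' by apply: sort_sorted => x y; exact: leq_total.
  move: ut'; elim: (tval t') => [//|x [//|y u] IH] /= /andP[xu uu] /andP[xy su].
  apply/andP; split; last exact: IH.
  rewrite ltn_neqAle xy andbT; apply: contra xu => /eqP /val_inj ->.
  by rewrite inE eqxx.
pose g : {ffun 'I_e -> 'I_n} := [ffun i => tnth t' i].
have gI : [forall i : 'I_e, forall k : 'I_e, (i < k)%N ==> (g i < g k)%N].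
  apply/forallP => i; apply/forallP => k; apply/implyP => ik.
  rewrite !ffunE !(tnth_nth (f i)).
  by apply: (sorted_ltn_nth _ (f i) st') => //;
    [move=> x y z; exact: ltn_trans|rewrite inE size_tuple..].
exists (exist _ g gI), s => i /=; rewrite ffunE.
have := congr1 (fun u : e.-tuple _ => tnth u i) (val_inj ts : t = [tuple tnth t' (s i) | i < e]).
by rewrite !tnth_mktuple.
Qed.

(** A repeated column gives the first alternative; otherwise the values of [f] are sorted. Index and
    sign depend on [f] alone, so that one choice serves several matrices at once. *)
Lemma minor_sort e n (f : 'I_e -> 'I_n) :
  (forall (R : comNzRingType) (M : 'M[R]_(e, n)), minor f M = 0) \/
  exists (I : plucker_index n e) (s : bool),
    forall (R : comNzRingType) (M : 'M[R]_(e, n)), minor f M = (-1) ^+ s * minor (val I) M.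
Proof.
have [/injectiveP fI|fNI] := boolP (injectiveb f); last first.
  by left => R M; apply: minor_not_injective.
right; have [I [s fs]] := injective_increasing_perm fI; exists I, (odd_perm s) => R M.
rewrite (eq_minor _ fs) /minor -odd_permV -det_perm mulrC -det_mulmx -col_permE; congr (\det _).
by apply/matrixP => i k; rewrite !mxE.
Qed.

Section RowSpan.
Variable F : fieldType.

Definition rowspan e n (M : 'M[F]_(e, n)) : {vspace 'rV[F]_n} :=
  <<[tuple row i M | i < e]>>%VS.

Lemma rowspanP e n (M : 'M[F]_(e, n)) v :
  reflect (exists x : 'rV_e, v = x *m M) (v \in rowspan M).
Proof.
apply: (iffP idP) => [/coord_span ->|[x ->]].
  exists (\row_i coord [tuple row i M | i < e] i v); rewrite mulmx_sum_row.
  by apply: eq_bigr => i _; rewrite mxE (nth_map i) ?size_enum_ord// nth_ord_enum.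
rewrite mulmx_sum_row; apply: memv_suml => i _; apply/memvZ/memv_span.
by apply/mapP; exists i; rewrite ?mem_enum.
Qed.

Lemma rowspan_basis e n (M : 'M[F]_(e, n)) : row_free M ->
  basis_of (rowspan M) [tuple row i M | i < e].
Proof.
move=> Mfree; rewrite /basis_of eqxx /=; apply/(@freeP F _ e [tuple row i M | i < e]) => k k0 i.
have := row_free_inj Mfree; move=> /(_ 1%N (\row_i k i) 0); rewrite mul0mx mulmx_sum_row.
move=> H; have /rowP/(_ i) : \row_i k i = 0.
  apply: H; rewrite -[RHS]k0; apply: eq_bigr => {}i _.
  by rewrite mxE (nth_map i) ?size_enum_ord// nth_ord_enum.
by rewrite !mxE.
Qed.

Lemma dim_rowspan e n (M : 'M[F]_(e, n)) : row_free M -> \dim (rowspan M) = e.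
Proof. by move=> /rowspan_basis/size_basis. Qed.

Definition tuple_mx e n (b : e.-tuple 'rV[F]_n) : 'M[F]_(e, n) :=
  \matrix_(i, k) tnth b i 0 k.

Lemma tuple_mxK e n (b : e.-tuple 'rV[F]_n) : [tuple row i (tuple_mx b) | i < e] = b.
Proof. by apply: eq_from_tnth => i; rewrite tnth_mktuple; apply/rowP => k; rewrite !mxE. Qed.

Lemma rowspan_tuple_mx e n B (b : e.-tuple 'rV[F]_n) : basis_of B b -> B = rowspan (tuple_mx b).
Proof. by rewrite /rowspan tuple_mxK => /span_basis. Qed.

Lemma tuple_mx_free e n B (b : e.-tuple 'rV[F]_n) : basis_of B b -> row_free (tuple_mx b).
Proof.
move=> /basis_free /(@freeP F _ e b) bf; rewrite -kermx_eq0; apply/rowV0P => x /sub_kermxP xb.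
apply/rowP => i; rewrite mxE; apply: (bf (fun i => x 0 i)).
rewrite -[RHS]xb mulmx_sum_row; apply: eq_bigr => k _.
rewrite -tnth_nth; congr (_ *: _); by apply/rowP => l; rewrite !mxE.
Qed.

Lemma rowspan_mulmx e n (P : 'M[F]_e) (M : 'M[F]_(e, n)) : P \in unitmx ->
  rowspan (P *m M) = rowspan M.
Proof.
move=> Pu; apply/vspaceP => v; apply/rowspanP/rowspanP => -[x ->].
  by exists (x *m P); rewrite mulmxA.
by exists (x *m invmx P); rewrite mulmxA mulmxKV.
Qed.

Lemma eq_rowspan e n (M N : 'M[F]_(e, n)) : row_free M -> row_free N ->
  rowspan M = rowspan N -> exists2 P, P \in unitmx & N = P *m M.
Proof.
move=> Mf Nf MN; have rP i : {x | row i N = x *m M}.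
  apply: cid; apply/rowspanP; rewrite MN; apply/rowspanP.
  by exists (delta_mx 0 i); rewrite -rowE.
pose P := \matrix_i sval (rP i).
have NP : N = P *m M.
  by apply/row_matrixP => i; rewrite row_mul rowK -(svalP (rP i)).
exists P => //; rewrite -row_free_unit -kermx_eq0; apply/rowV0P => x /sub_kermxP xP.
by apply: (row_free_inj Nf); rewrite NP mulmxA xP !mul0mx.
Qed.

Lemma row_free_minor e n (M : 'M[F]_(e, n)) : row_free M ->
  exists I : plucker_index n e, minor (val I) M != 0.
Proof.
rewrite /row_free -mxrank_tr -/(row_full _) => Mf.
have := fullrowsub_unit Mf; rewrite -unitmx_tr unitmxE unitfE.
set f := fullrankfun Mf => f0.
have mf : minor f M != 0.
  by move: f0; rewrite /minor; congr (\det _ != 0); apply/matrixP => i k; rewrite !mxE.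
have [m0|[I [s Is]]] := minor_sort f; first by rewrite m0 eqxx in mf.
by exists I; move: mf; rewrite Is mulf_eq0 signr_eq0.
Qed.

End RowSpan.

(** * Heights *)

Lemma plucker_coordinatesE (R : realType) n e (B : {vspace 'rV[R]_n}) xi :
  plucker_coordinates B xi <->
  exists M : 'M[R]_(e, n), [/\ row_free M, B = rowspan M & forall I, xi I = minor (val I) M].
Proof.
split=> [[b Bb xib]|[M [Mf -> xiM]]].
  exists (tuple_mx b); split; [exact: tuple_mx_free Bb|exact: rowspan_tuple_mx|].
  by move=> I; rewrite xib; congr (\det _); apply/matrixP => i k; rewrite !mxE.
exists [tuple row i M | i < e]; first exact: rowspan_basis.
by move=> I; rewrite xiM; congr (\det _); apply/matrixP => i k; rewrite !mxE tnth_mktuple mxE.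
Qed.

Lemma plucker_dim (R : realType) n e (B : {vspace 'rV[R]_n}) (xi : plucker_index n e -> R) :
  plucker_coordinates B xi -> \dim B = e.
Proof. by case/plucker_coordinatesE => M [Mf -> _]; exact: dim_rowspan. Qed.

(** The factor is the determinant of the change of basis. *)
Lemma plucker_proportional (R : realType) n e (B : {vspace 'rV[R]_n})
    (xi zeta : plucker_index n e -> R) :
  plucker_coordinates B xi -> plucker_coordinates B zeta ->
  exists2 a, a != 0 & forall I, zeta I = a * xi I.
Proof.
move=> /plucker_coordinatesE[M [Mf -> xiM]] /plucker_coordinatesE[N [Nf MN zN]].
have [P Pu NP] := eq_rowspan Mf Nf MN.
exists (\det P) => [|I]; first by rewrite -unitfE -unitmxE.
by rewrite xiM zN NP minor_mulmx.
Qed.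

Lemma plucker_neq0 (R : realType) n e (B : {vspace 'rV[R]_n}) (xi : plucker_index n e -> R) :
  plucker_coordinates B xi -> exists I, xi I != 0.
Proof.
move=> /plucker_coordinatesE[M [/row_free_minor[I MI] _ xiM]].
by exists I; rewrite xiM.
Qed.

Lemma gcd_bezout (T : finType) (X : T -> int) :
  exists c : T -> int, \sum_I c I * X I = (\big[gcdn/0%N]_I `|X I|%N)%:Z.
Proof.
suff [c cX] : exists c : T -> int,
    \sum_(I <- index_enum T) c I * X I = (\big[gcdn/0%N]_(I <- index_enum T) `|X I|%N)%:Z.
  by exists c.
elim: (index_enum T) (index_enum_uniq T) => [_|I r IH /= /andP[Ir ur]].
  by exists (fun=> 0); rewrite !big_nil.
have [c cX] := IH ur.
set g := \big[gcdn/0%N]_(J <- r) `|X J|%N in cX.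
have [u [v uv]] := Bezoutz (X I) g%:Z.
(* [I] does not occur in [r], so resetting the coefficient at [I] does not disturb the sum over
   [r]. *)
exists (fun J => if J == I then u else v * c J); rewrite !big_cons eqxx.
have -> : \sum_(J <- r) (if J == I then u else v * c J) * X J = v * g.
  rewrite -cX mulr_sumr big_seq [RHS]big_seq; apply: eq_bigr => J Jr.
  by case: eqP Jr Ir => [-> ->//|_ _ _]; rewrite mulrA.
by rewrite uv.
Qed.

(** A Bezout relation for [X], multiplied by [a], writes [a] as an integral combination of the
    [M I]. *)
Lemma coprime_multiple_int (R : realType) n e (X M : plucker_index n e -> int) (a : R) :
  setwise_coprime X -> (forall I, (M I)%:~R = a * (X I)%:~R) -> exists z : int, a = z%:~R.
Proof.
move=> Xc MX; have [c cX] := gcd_bezout X.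
exists (\sum_I c I * M I); transitivity (a * (\sum_I c I * X I)%:~R).
  by rewrite cX Xc mulr1.
rewrite !rmorph_sum /= mulr_sumr; apply: eq_bigr => I _.
by rewrite !rmorphM /= MX; ring.
Qed.

Definition int_norm (R : realType) (T : finType) (X : T -> int) : R :=
  Num.sqrt (\sum_I (X I)%:~R ^+ 2).

Lemma int_norm_ge (R : realType) (T : finType) (X : T -> int) I :
  `|X I|%:~R <= int_norm R X.
Proof.
rewrite intr_norm -sqrtr_sqr ler_sqrt; last by apply: sumr_ge0 => J _; exact: sqr_ge0.
by rewrite (bigD1 I)//= lerDl sumr_ge0// => J _; exact: sqr_ge0.
Qed.

Lemma int_norm_le (R : realType) (T : finType) (X : T -> int) (D : R) :
  (forall I, `|(X I)%:~R| <= D) -> 0 <= D -> int_norm R X <= #|T|%:R * D.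
Proof.
move=> XD D0; rewrite -[leRHS]ger0_norm ?mulr_ge0// -sqrtr_sqr ler_sqrt ?sqr_ge0//.
apply: (@le_trans _ _ (\sum_(I : T) D ^+ 2)).
  by apply: ler_sum => I _; rewrite -[leLHS]real_normK ?num_real// lerXn2r// ?nnegrE.
rewrite sumr_const exprMn -[leLHS]mulr_natl ler_wpM2r ?sqr_ge0// -natrX ler_nat.
by case: #|_| => // k; rewrite leq_pmull.
Qed.

(** An integral Pluecker vector is a nonzero integral multiple of the coprime one, hence at least as
    long. If no height existed, the default value 0 would satisfy the bound too. *)
Lemma height_le_int_norm (R : realType) n e (B : {vspace 'rV[R]_n}) (M : plucker_index n e -> int) :
  plucker_coordinates B (fun I => (M I)%:~R) -> height B <= int_norm R M.
Proof.
move=> MB; have := plucker_dim MB; rewrite /height => eB.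
case: xgetP => [h _ [X [XB Xc ->]]|_]; last exact: sqrtr_ge0.
subst e; have [a a0 MX] := plucker_proportional XB MB.
have [z az] := coprime_multiple_int Xc MX.
have z0 : z != 0 by apply: contra_neq a0 => z0; rewrite az z0.
rewrite ler_sqrt; last by apply: sumr_ge0 => J _; exact: sqr_ge0.
apply: ler_sum => I _; rewrite MX exprMn ler_peMl ?sqr_ge0// az -rmorphXn /=.
by rewrite (_ : 1 = 1%:~R)// ler_int; move: z0; clear; nia.
Qed.

Lemma rat_common_denominator n e (Q : 'M[rat]_(e, n)) :
  exists D : int, exists N : 'M[int]_(e, n), D != 0 /\ D%:~R *: Q = map_mx intr N.
Proof.
pose D := \prod_i \prod_k denq (Q i k).
have DQ i k : (D%:~R * Q i k) \is a Num.int.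
  rewrite /D (bigD1 i)//= (bigD1 k)//= !intrM.
  set a := (\prod_(l | l != k) _); set b := (\prod_(l | l != i) _).
  rewrite (_ : _ * _ = (numq (Q i k))%:~R * a%:~R * b%:~R); last by rewrite numqE; ring.
  by rewrite !rpredM ?intr_int.
exists D, (\matrix_(i, k) Num.floor (D%:~R * Q i k)); split.
  by apply/prodf_neq0 => i _; apply/prodf_neq0 => k _; exact: denq_neq0.
by apply/matrixP => i k; rewrite !mxE floorK.
Qed.

Lemma rational_subspacesP (R : realType) n e (B : {vspace 'rV[R]_n}) :
  rational_subspaces e B <->
  exists N : 'M[int]_(e, n), row_free (map_mx intr N : 'M[R]_(e, n)) /\ B = rowspan (map_mx intr N).
Proof.
split=> [[[b Bb] dB]|[N [Nf BN]]]; last first.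
  split; last by rewrite BN dim_rowspan.
  exists [seq row i (map_mx intr N) | i <- enum 'I_e].
  rewrite BN; have := rowspan_basis Nf; congr (basis_of _ _).
  rewrite /= -map_comp; apply: eq_map => i /=.
  by apply/rowP => k; rewrite !mxE ratr_int.
have sb : size b == e.
  have sb := size_basis (X := in_tuple [seq map_mx ratr v | v <- b]) Bb.
  by rewrite -dB sb size_map.
pose t := [tuple of map (map_mx ratr : 'rV[rat]_n -> 'rV[R]_n) (Tuple sb)].
have Bt : basis_of B t by [].
pose Q := \matrix_(i, k) tnth (Tuple sb) i 0 k.
have tQ : tuple_mx t = map_mx ratr Q.
  by apply/matrixP => i k; rewrite !mxE tnth_map mxE.
have [D [N [D0 DN]]] := rat_common_denominator Q.
have rN : map_mx intr N = D%:~R%:M *m tuple_mx t.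
  rewrite mul_scalar_mx tQ; apply/matrixP => i k; have /matrixP/(_ i k) := DN.
  rewrite !mxE => DNik; rewrite -[LHS](ratr_int R) -DNik rmorphM /= ratr_int //.
have Du : (D%:~R%:M : 'M[R]_e) \in unitmx.
  by rewrite unitmxE det_scalar unitfE expf_neq0// intr_eq0.
exists N; split; last by rewrite rN rowspan_mulmx//; exact: rowspan_tuple_mx.
by rewrite rN /row_free mxrankMfree ?(tuple_mx_free Bt)// mxrank_unit.
Qed.

(** The minors of an integral basis, divided by their gcd, are coprime by Bezout. *)
Lemma is_height_exists (R : realType) n e (B : {vspace 'rV[R]_n}) : (0 < e)%N ->
  rational_subspaces e B -> exists h, is_height B h.
Proof.
move=> e0 rB; move: (rB) => [_ dB]; move/rational_subspacesP : rB => [N [Nf BN]].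
subst e; set e := \dim B in N Nf BN *.
pose X0 (I : plucker_index n e) := minor (val I) N.
pose g := \big[gcdn/0%N]_I `|X0 I|%N.
have gX I : (g%:Z %| X0 I)%Z.
  by rewrite dvdzE /=; exact: (biggcdn_inf I).
have XX I : X0 I = g%:Z * (X0 I %/ g%:Z)%Z by rewrite mulrC divzK.
have g0 : g != 0%N.
  have [I] := row_free_minor Nf; rewrite minor_map; apply: contraNneq => g0.
  by rewrite -/(X0 I) XX g0 mul0r.
pose X I := (X0 I %/ g%:Z)%Z.
have [c cX] := gcd_bezout X0.
exists (int_norm R X); exists X; split=> //.
  apply/plucker_coordinatesE.
  (* Dividing a single row by [g] divides every minor by [g]; there is a row because [e] is
     positive. *)
  pose P : 'M[R]_e := diag_mx (\row_i (if i == Ordinal e0 then g%:R^-1 else 1)).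
  have dP : \det P = g%:R^-1.
    rewrite det_diag (bigD1 (Ordinal e0))//= mxE eqxx big1 ?mulr1// => i /negPf i0.
    by rewrite mxE i0.
  have Pu : P \in unitmx by rewrite unitmxE dP unitfE invr_eq0 pnatr_eq0.
  exists (P *m map_mx intr N); split; last 1 first.
  - move=> I; rewrite minor_mulmx minor_map dP -/(X0 I) [in RHS]XX rmorphM /= mulrA mulVf ?mul1r//.
    by rewrite pnatr_eq0.
  - by rewrite /row_free mxrankMfree// mxrank_unit.
  - by rewrite rowspan_mulmx.
rewrite /setwise_coprime; set h := (LHS).
have : (h%:Z %| 1%R)%Z.
  suff <- : \sum_I c I * X I = 1.
    apply: rpred_sum => I _; apply: dvdz_mull.
    by rewrite dvdzE /=; exact: (biggcdn_inf I).
  apply: (mulfI (x := g%:Z)); first by rewrite eqz_nat.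
  rewrite mulr1 -[RHS]cX mulr_sumr; apply: eq_bigr => I _.
  by rewrite [in RHS]XX; ring.
by rewrite dvdzE /= dvdn1 => /eqP.
Qed.

Lemma heightP (R : realType) n e (B : {vspace 'rV[R]_n}) : (0 < e)%N ->
  rational_subspaces e B -> exists X : plucker_index n e -> int,
    [/\ plucker_coordinates B (fun I => (X I)%:~R), setwise_coprime X & height B = int_norm R X].
Proof.
move=> e0 rB; have [h hB] := is_height_exists e0 rB; move: rB => [_ dB]; subst e.
by have /= [X [XB Xc Xh]] := xgetPex 0 (ex_intro _ h hB); exists X.
Qed.

Lemma height_ge1 (R : realType) n e (B : {vspace 'rV[R]_n}) : (0 < e)%N ->
  rational_subspaces e B -> 1 <= height B.
Proof.
move=> e0 /(heightP e0)[X [XB _ ->]].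
have [I] := plucker_neq0 XB; rewrite intr_eq0 => XI.
by apply: le_trans (int_norm_ge R X I); rewrite (_ : 1 = 1%:~R)// ler_int; lia.
Qed.

(** Expand along the replaced column: the cofactors are those of the identity matrix. In this way
    the minors determine every entry of a normalized basis. *)
Lemma minor_replace_column (R : comNzRingType) e n (f : 'I_e -> 'I_n) (E : 'M[R]_(e, n)) i k :
  mxsub id f E = 1%:M -> minor (fun r => if r == i then k else f r) E = E i k.
Proof.
move=> E1; rewrite /minor (expand_det_col _ i).
have cof r : cofactor (mxsub id (fun r => if r == i then k else f r) E) r i =
             (r == i)%:R.
  have <- : cofactor (1%:M : 'M[R]_e) r i = (r == i)%:R.
    by have /matrixP/(_ i r) := adj1 R e; rewrite !mxE eq_sym.
  rewrite /cofactor -E1; congr (_ * \det _); apply/matrixP => a b.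
  by rewrite !mxE eq_sym (negPf (neq_lift _ _)).
rewrite (bigD1 i)//= cof !mxE !eqxx mulr1 big1 ?addr0// => r /negPf ri.
by rewrite cof ri mulr0.
Qed.

Lemma normalized_basis (R : realType) n e (B : {vspace 'rV[R]_n})
    (xi : plucker_index n e -> R) I0 : plucker_coordinates B xi -> xi I0 != 0 ->
  exists E : 'M[R]_(e, n), [/\ row_free E, B = rowspan E, mxsub id (val I0) E = 1%:M &
     forall I, xi I = xi I0 * minor (val I) E].
Proof.
move=> /plucker_coordinatesE[M [Mf -> xiM]] x0.
have uM : mxsub id (val I0) M \in unitmx by rewrite unitmxE -/(minor _ M) -xiM unitfE.
exists (invmx (mxsub id (val I0) M) *m M); split.
- by rewrite /row_free mxrankMfree// mxrank_unit// unitmx_inv.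
- by rewrite rowspan_mulmx// unitmx_inv.
- by rewrite -mulmx_colsub mulVmx.
- by move=> I; rewrite minor_mulmx det_inv -/(minor _ M) -!xiM mulrA divff ?mul1r.
Qed.

(** Both subspaces have a basis normalized on the same columns, and the entries of such a basis are,
    up to sign, quotients of Pluecker coordinates. *)
Lemma plucker_inj (R : realType) n e (B C : {vspace 'rV[R]_n}) (xi : plucker_index n e -> R) :
  plucker_coordinates B xi -> plucker_coordinates C xi -> B = C.
Proof.
move=> xB xC; have [I0 x0] := plucker_neq0 xB.
have [E [_ -> E1 xE]] := normalized_basis xB x0.
have [G [_ -> G1 xG]] := normalized_basis xC x0.
congr (rowspan _); apply/matrixP => i k.
rewrite -(minor_replace_column _ _ E1) -(minor_replace_column _ _ G1).
have [m0|[I [s Is]]] := minor_sort (fun r => if r == i then k else val I0 r).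
  by rewrite !m0.
by rewrite !Is; congr (_ * _); apply: (mulfI x0); rewrite -xE xG.
Qed.

(** Northcott's property: the height bounds every coprime coordinate, which leaves finitely many
    integral vectors, and each of them determines its subspace. *)
Lemma finite_height_le (R : realType) n e (h : R) : (0 < e)%N ->
  finite_set [set B : {vspace 'rV[R]_n} | rational_subspaces e B /\ height B <= h].
Proof.
move=> e0; pose K := Num.bound h.
(* The shift by [K] encodes the integers from [-K] to [K]. *)
pose xi (phi : {ffun plucker_index n e -> 'I_K.*2.+1}) (I : plucker_index n e) : R :=
  ((phi I)%:Z - K%:Z)%:~R.
pose G phi : {vspace 'rV[R]_n} := xget 0%VS [set B | plucker_coordinates B (xi phi)].
apply: (@sub_finite_set _ _ (G @` setT)); last by apply: finite_image; exact: finite_finset.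
move=> B [rB hB]; have [X [XB _ hX]] := heightP e0 rB.
have XK I : (`|X I| < K)%N.
  have := le_trans (int_norm_ge R X I); rewrite -hX => /(_ _ hB).
  have h0 : 0 <= h by rewrite (le_trans _ hB)// (le_trans ler01)// (height_ge1 e0 rB).
  by move=> /le_lt_trans /(_ (archi_boundP h0)); rewrite ltr_nat.
exists [ffun I => inord (absz (X I + K%:Z))] => //.
have xiX : xi [ffun I => inord (absz (X I + K%:Z))] = (fun I => (X I)%:~R).
  apply/funext => I; rewrite /xi ffunE inordK; last by have := XK I; lia.
  by congr (_%:~R); have := XK I; lia.
rewrite /G; case: xgetP => [C _|/(_ B)]; rewrite /= xiX => XC; last by case: XC.
exact: plucker_inj XC XB.
Qed.

(** * Rational subspaces of small height above a given one *)

(* The group of integral [u] with [u U T] divisible by [D] is a product of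
   cyclic groups, generated by the [k i] times the standard basis vectors. *)
Lemma smith_denominators l n (T : 'M[int]_(l, n)) (D : nat) : (0 < D)%N -> (l <= n)%N ->
  exists (U : 'M[int]_l) (k : 'I_l -> nat), [/\ U \in unitmx,
    forall i, (0 < k i <= D)%N,
    forall i j, (D %| (diag_mx (\row_i (k i)%:Z) *m U *m T) i j)%Z &
    forall u : 'rV[int]_l, (forall j, (D %| (u *m U *m T) 0%R j)%Z) ->
      forall i, (k i %| u 0%R i)%Z].
Proof.
move=> D0 ln; have [L Lu [R Ru [d _ TE]]] := int_Smith_normal_form T.
pose S : 'M[int]_(l, n) := \matrix_(i, j) (d`_i *+ (i == j :> nat)).
rewrite -/S in TE.
have UT m (u : 'M[int]_(m, l)) : u *m invmx L *m T = u *m S *m R.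
  by rewrite TE -!mulmxA mulKmx.
have uS m (u : 'M[int]_(m, l)) i (j : 'I_l) : (u *m S) i (widen_ord ln j) = u i j * d`_j.
  rewrite mxE (bigD1 j)//= mxE eqxx mulr1n big1 ?addr0// => a /negPf aj.
  by rewrite mxE /= val_eqE aj mulr0n mulr0.
have uS0 m (u : 'M[int]_(m, l)) i (j : 'I_n) : (l <= j)%N -> (u *m S) i j = 0.
  move=> lj; rewrite mxE big1// => a _; rewrite mxE.
  by rewrite ltn_eqF ?mulr0// (leq_trans (ltn_ord a)).
(* [D %/ g i] is the least positive [k] such that [D] divides [k * d_i]; it is 1 when [d_i] is 0, in
   particular beyond the end of [d]. *)
pose g i := gcdn D (absz d`_i).
have g0 i : (0 < g i)%N by rewrite gcdn_gt0 D0.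
have gD i : (g i %| D)%N by rewrite dvdn_gcdl.
exists (invmx L), (fun i => D %/ g i)%N; split.
- by rewrite unitmx_inv.
- by move=> i; rewrite divn_gt0// dvdn_leq//= leq_div.
- move=> i j; rewrite UT mxE; apply: rpred_sum => a _; apply: dvdz_mulr.
  have [la|al] := leqP l a; first by rewrite uS0// dvdz0.
  have -> : a = widen_ord ln (Ordinal al) by apply/val_inj.
  rewrite uS !mxE.
  have [->|_] := eqVneq i (Ordinal al); rewrite ?mulr1n ?mulr0n ?mul0r ?dvdz0//.
  by rewrite dvdzE abszM /= mulnC /g gcdnC muln_divCA_gcd dvdn_mulr.
move=> u uD i.
have : (D%:Z %| (u *m S) 0%R (widen_ord ln i))%Z.
  rewrite -[u *m S](mulmxK Ru) -UT mxE; apply: rpred_sum => a _.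
  by apply: dvdz_mulr.
rewrite uS !dvdzE abszM /=.
move=> Dud; have : (D %| absz (u ord0 i) * g i)%N.
  by rewrite muln_gcdr dvdn_gcd Dud dvdn_mull.
by rewrite -{1}(divnK (gD i)) dvdn_pmul2r.
Qed.

Lemma pigeonhole (S T : finType) (A : {pred S}) (f : S -> T) : (#|T| < #|A|)%N ->
  exists x y, [/\ x \in A, y \in A, x != y & f x = f y].
Proof.
move=> TA; apply: contrapT => H; move: TA; apply/negP; rewrite -leqNgt.
apply: (leq_trans _ (max_card (mem [set f x | x in A]))); rewrite card_in_imset// => x y xA yA fxy.
by apply/eqP; apply: contrapT => /negP xy; apply: H; exists x, y.
Qed.

(** [M] is the [m]-th root of [D], rounded up, minus 1. With [M ^ m] boxes the pigeonhole principle
    applies to [D] points, while [M.+1] is still at least the root. *)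
Lemma root_floor m D : (0 < m)%N -> (1 < D)%N -> exists M, [/\ 0 < M, M ^ m < D & D <= M.+1 ^ m]%N.
Proof.
move=> m0 D1; have ex1 : exists M, (M ^ m < D)%N by exists 1%N; rewrite exp1n.
have exD M : (M ^ m < D)%N -> (M <= D)%N.
  move=> MD; apply: leq_trans (ltnW MD); case: M {MD} => // M.
  by rewrite -[leqLHS]expn1 leq_pexp2l.
case: (ex_maxnP ex1 exD) => M MD maxM; exists M; split=> //.
  by apply: maxM; rewrite exp1n.
by rewrite leqNgt; apply/negP => /maxM; rewrite ltnn.
Qed.

Lemma sub_floor_bounds (R : realType) (x : R) : 0 <= x - (Num.floor x)%:~R < 1.
Proof. by have := floor_itv x; rewrite intrD; lra. Qed.

(** * Short vectors modulo a rational subspace *)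

Section ShortVector.
Variables (R : realType) (l n D : nat) (E : 'M[R]_(l, n)) (f : 'I_l -> 'I_n).
Hypotheses (D0 : (0 < D)%N) (ln : (l < n)%N) (E1 : mxsub id f E = 1%:M).
Hypothesis DE : forall i k, exists z : int, D%:R * E i k = z%:~R.
(** In terms of lattices: the integral [x] with [x E] integral form a subgroup of index at least [D]
    in [Z^l]. *)
Hypothesis minD : forall (Q : 'M[int]_l) (N : 'M[int]_(l, n)), \det Q != 0 ->
  map_mx intr Q *m E = map_mx intr N -> (D <= `|\det Q|)%N.

Lemma pivot_entry i j : E i (f j) = (i == j)%:R.
Proof. by have /matrixP/(_ i j) := E1; rewrite !mxE. Qed.

Lemma pivot_injective : injective f.
Proof.
move=> i j fij; apply/eqP; apply: contrapT => /negP ij.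
have := pivot_entry i j; rewrite -fij pivot_entry (negPf ij) eqxx => /eqP.
by rewrite oner_eq0.
Qed.

Lemma rowspan_pivot (x : 'rV[R]_n) : x \in rowspan E -> (forall i, x 0 (f i) = 0) -> x = 0.
Proof.
case/rowspanP => y -> y0; suff -> : y = 0 by rewrite mul0mx.
apply/rowP => i; rewrite [RHS]mxE -(y0 i) mxE (bigD1 i)//= pivot_entry eqxx mulr1 big1 ?addr0//.
by move=> j /negPf ji; rewrite pivot_entry ji mulr0.
Qed.

(** [T = D E] is integral, and [x E] is integral exactly when [D] divides [x T], so the Smith form
    applies. The matrix [diag(k) U] is admissible in [minD] and has determinant [prod k] up to sign.
    Hence the vectors [u U E] with [0 <= u i < k i] are pairwise incongruent modulo [Z^n], and there
    are at least [D] of them. *)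
Lemma many_classes : exists (U : 'M[int]_l) (k : 'I_l -> nat), [/\
  (D <= \prod_i k i)%N, forall i, (k i <= D)%N &
  forall (u : 'rV[int]_l) (z : 'rV[int]_n), map_mx intr (u *m U) *m E = map_mx intr z ->
      forall i, (k i %| u ord0 i)%Z].
Proof.
pose T : 'M[int]_(l, n) := \matrix_(i, j) Num.floor (D%:R * E i j).
have TE : map_mx intr T = D%:R *: E.
  by apply/matrixP => i j; rewrite !mxE; have [z ->] := DE i j; rewrite intrKfloor.
have D0R : (D%:R : R) != 0 by rewrite pnatr_eq0 -lt0n.
have TEm m (Q : 'M[int]_(m, l)) : map_mx intr (Q *m T) = D%:R *: (map_mx intr Q *m E).
  by rewrite map_mxM TE scalemxAr.
have [U [k [Uu kD kT ku]]] := smith_denominators T D0 (ltnW ln).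
exists U, k; split; last 1 first.
- move=> u z uz; apply: ku => j.
  have /matrixP/(_ ord0 j) := TEm _ (u *m U); rewrite uz !mxE.
  move=> /eqP; rewrite -[D%:R]/(D%:Z%:~R) -rmorphM eqr_int => /eqP ->.
  exact: dvdz_mulr.
- pose Q := diag_mx (\row_i (k i)%:Z) *m U.
  have dQ : `|\det Q|%N = (\prod_i k i)%N.
    rewrite /Q det_mulmx abszM det_diag.
    have -> : `|\det U|%N = 1%N.
      move: Uu; rewrite unitmxE => /unitrP[x [_ /(congr1 absz)]].
      by rewrite abszM => /eqP; rewrite muln_eq1 => /andP[/eqP].
    rewrite muln1 (big_morph absz abszM (erefl : absz 1 = 1%N)).
    by apply: eq_bigr => i _; rewrite mxE.
  rewrite -dQ; apply: (minD (N := \matrix_(i, j) ((Q *m T) i j %/ D)%Z)).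
    rewrite -absz_eq0 dQ -lt0n prodn_gt0// => i.
    by have /andP[] := kD i.
  apply: (scalerI D0R); rewrite -TEm; apply/matrixP => i j; rewrite !mxE.
  rewrite -[D%:R]/(D%:Z%:~R) -rmorphM /= mulrC divzK//.
  by have := kT i j; rewrite mxE.
- by move=> i; have /andP[] := kD i.
Qed.

Lemma exists_short_vector : exists (v : 'rV[int]_n) (w : 'rV[R]_n),
  [/\ w != 0, forall i, w 0 (f i) = 0, map_mx intr v + w \in rowspan E &
      forall k, D%:R * `|w 0 k| ^+ (n - l) <= 2 ^+ (n - l)].
Proof.
pose K : finType := {k : 'I_n | k \notin codom f}.
have cardN : #|K| = (n - l)%N.
  rewrite card_sig -[in RHS](card_ord n) -(cardC (mem (codom f))).
  rewrite card_codom; last exact: pivot_injective.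
  by rewrite card_ord addKn; apply: eq_card => x; rewrite !inE.
have nl : (0 < n - l)%N by rewrite subn_gt0.
(* For [D = 1] two different classes need not exist; there [w] is minus a standard basis vector off
   the pivot columns and [v + w = 0]. *)
have [D1|D1] := leqP D 1.
  have /card_gt0P[[k0 k0f] _] : (0 < #|K|)%N by rewrite cardN.
  exists (delta_mx 0 k0), (- delta_mx 0 k0); split.
  - apply/eqP => /rowP/(_ k0); rewrite !mxE !eqxx => /eqP.
    by rewrite oppr_eq0 oner_eq0.
  - move=> i; rewrite !mxE /=; case: eqP => [fk|]; last by rewrite oppr0.
    by case/negP: k0f; rewrite -fk codom_f.
  - suff -> : map_mx intr (delta_mx 0 k0) - delta_mx 0 k0 = 0 :> 'rV[R]_n by rewrite mem0v.
    by apply/matrixP => i j; rewrite !mxE; case: (_ && _); rewrite subrr.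
  - move=> k; rewrite !mxE normrN; have -> : D = 1%N by apply/eqP; rewrite eqn_leq D1.
    rewrite mul1r; case: (_ && _); rewrite /= ?normr1 ?normr0 ?expr1n ?expr0n ?gtn_eqF//=.
      by rewrite exprn_ege1// ler1n.
    by rewrite exprn_ge0.
have [[|M] [M0 MD DM]] := root_floor nl D1; first by [].
have [U [k [kD kiD ku]]] := many_classes.
pose vec (u : {ffun 'I_l -> 'I_D.+1}) : 'rV[int]_l := \row_i (u i)%:Z.
pose Y u : 'rV[R]_n := map_mx intr (vec u *m U) *m E.
pose fr (x : R) := x - (Num.floor x)%:~R.
(* The fractional parts in the [n - l] columns off the pivots, each located in one of [M.+1]
   intervals of length [1 / M.+1]. *)
pose box u : {ffun K -> 'I_M.+1} :=
  [ffun a => inord (Num.truncn (M.+1%:R * fr (Y u 0 (val a))))].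
pose A : {pred {ffun 'I_l -> 'I_D.+1}} := family (fun i => [pred x : 'I_D.+1 | x < k i]%N).
have cardA : #|A| = (\prod_i k i)%N.
  rewrite /A card_family foldrE big_map big_enum /=; apply: eq_bigr => i _.
  rewrite -sum1_card (eq_bigl (fun x : 'I_D.+1 => (x < k i)%N))//.
  by rewrite (big_ord_narrow (leqW (kiD i))) sum1_card card_ord.
have [|u [u' [/familyP uA /familyP u'A uu' /ffunP buu']]] := @pigeonhole _ _ A box.
  by rewrite cardA card_ffun card_ord cardN (leq_trans MD).
pose v := \row_j (Num.floor (Y u 0 j) - Num.floor (Y u' 0 j)).
pose w := \row_j (fr (Y u 0 j) - fr (Y u' 0 j)).
have vw : map_mx intr v + w = Y u - Y u'.
  by apply/rowP => j; rewrite !mxE /fr intrB; ring.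
have YU : Y u - Y u' = map_mx intr ((vec u - vec u') *m U) *m E.
  by rewrite mulmxBl map_mxB mulmxBl.
(* In the pivot columns [Y u] has the integral coordinates of [u U], whose fractional parts
   vanish. *)
have wf i : w 0 (f i) = 0.
  rewrite mxE; have intY t : Y t 0 (f i) = ((vec t *m U) 0 i)%:~R.
    rewrite /Y mxE (bigD1 i)//= pivot_entry eqxx mulr1 big1 ?addr0 ?mxE//.
    by move=> j /negPf ji; rewrite pivot_entry ji mulr0.
  by rewrite /fr !intY !intrKfloor !subrr.
exists v, w; split.
(* If [w = 0], then [(u - u') U E] is integral, so [k i] divides [u i - u' i]; both entries lie in
   [[0, k i)], hence agree. *)
- apply: contra_neq uu' => w0; apply/ffunP => i; apply/val_inj.
  have := ku (vec u - vec u') v; rewrite -YU -vw w0 addr0 => /(_ erefl i).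
  rewrite !mxE dvdzE /=; have := uA i; have := u'A i; rewrite !inE => ui u'i.
  move=> /dvdnP[q]; move: (nat_of_ord (u i)) (nat_of_ord (u' i)) ui u'i => a b.
  by case: q => [|q]; rewrite ?mul0n ?mulSn; lia.
- exact: wf.
- by rewrite vw YU; apply/rowspanP; exists (map_mx intr ((vec u - vec u') *m U)).
move=> a.
have wM : `|w 0 a| <= M.+1%:R^-1.
  have [/codomP[i ->]|af] := boolP (a \in codom f).
    by rewrite wf normr0 invr_ge0.
  have := buu' (exist _ a af); rewrite !ffunE /= => /(congr1 val) /=.
  have frM (x : R) : 0 <= M.+1%:R * fr x < M.+1%:R.
    have /andP[fr0 fr1] : 0 <= fr x < 1 := sub_floor_bounds x.
    by rewrite mulr_ge0//= gtr_pMr ?ltr0n.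
  have truncM (x : R) : (Num.truncn (M.+1%:R * fr x) < M.+1)%N.
    have /andP[h0 h1] := frM x; rewrite -(ltr_nat R).
    by apply: le_lt_trans h1; rewrite truncn_le.
  rewrite !inordK// => tt.
  have /andP[/truncn_itv/andP[a1 a2] _] := frM (Y u 0 a).
  have /andP[/truncn_itv/andP[b1 b2] _] := frM (Y u' 0 a).
  rewrite -[leRHS]div1r ler_pdivlMr ?ltr0n// -[M.+1%:R]ger0_norm// -normrM ler_norml mxE.
  rewrite mulrBl ![_ * M.+1%:R]mulrC; move: a1 a2 b1 b2; rewrite tt -(natr1 (Num.truncn _)).
  move: (_ * _) (_ * _) => y y' a1 a2 b1 b2; apply/andP; split; lra.
rewrite -(@ler_pM2r _ (M.+1%:R ^+ (n - l))) ?exprn_gt0 ?ltr0n//.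
rewrite -mulrA -exprMn; apply: (@le_trans _ _ D%:R).
  rewrite ler_piMr// exprn_ile1 ?mulr_ge0//.
  by rewrite -ler_pdivlMr ?ltr0n// div1r.
(* The factor 2 comes from [M + 2 <= 2 (M + 1)]. *)
rewrite -exprMn -!natrM -natrX ler_nat (leq_trans DM)// leq_exp2r//; lia.
Qed.
End ShortVector.

(** * Adjoining one vector to a rational subspace *)

Lemma rowspan_col_mx (F : fieldType) a b n (A : 'M[F]_(a, n)) (B : 'M[F]_(b, n)) :
  rowspan (col_mx A B) = (rowspan A + rowspan B)%VS.
Proof.
apply/vspaceP => v; apply/rowspanP/memv_addP.
  move=> [x ->]; exists (lsubmx x *m A); first by apply/rowspanP; exists (lsubmx x).
  exists (rsubmx x *m B); first by apply/rowspanP; exists (rsubmx x).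
  by rewrite -mul_row_col hsubmxK.
move=> [_ /rowspanP[x ->] [_ /rowspanP[y ->] ->]].
by exists (row_mx x y); rewrite mul_row_col.
Qed.

Lemma minor_col_mx (R : comNzRingType) l n (v : 'rV[R]_n) (M : 'M[R]_(l, n))
    (g : 'I_(1 + l) -> 'I_n) :
  minor g (col_mx v M) =
  \sum_(j < 1 + l) v 0 (g j) * ((-1) ^+ j * minor (fun i => g (lift j i)) M).
Proof.
rewrite /minor (expand_det_row _ 0); apply: eq_bigr => j _.
have -> : mxsub id g (col_mx v M) 0 j = v 0 (g j).
  by rewrite !mxE; case: splitP => // k _; rewrite [k]ord1.
rewrite /cofactor add0n; congr (_ * (_ * \det _)); apply/matrixP => a b; rewrite !mxE.
case: splitP => k; first by rewrite [k]ord1.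
by rewrite /= add1n => -[ak]; congr (M _ _); apply/val_inj.
Qed.

(** The row operation is unipotent. It serves to trade an integral row for a short one with the same
    minors. *)
Lemma minor_col_mx_addr (R : comNzRingType) l n (v : 'rV[R]_n) x (M : 'M[R]_(l, n)) g :
  minor g (col_mx (v + x *m M) M) = minor g (col_mx v M).
Proof.
have -> : col_mx (v + x *m M) M = block_mx 1%:M x 0 1%:M *m col_mx v M.
  by rewrite mul_block_col !mul1mx mul0mx add0r.
by rewrite (@minor_mulmx _ (1 + l)) det_ublock !det1 !mul1r.
Qed.

Lemma row_free_col_mx (F : fieldType) l n (v : 'rV[F]_n) (M : 'M[F]_(l, n)) :
  row_free M -> v \notin rowspan M -> row_free (col_mx v M).
Proof.
move=> Mf vM; rewrite -kermx_eq0; apply/rowV0P => x /sub_kermxP.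
rewrite -[x]hsubmxK mul_row_col; set a := lsubmx x; set y := rsubmx x.
rewrite [a]mx11_scalar mul_scalar_mx => ayM.
have a0 : a 0 0 = 0.
  apply: contraNeq vM => a0; apply/rowspanP; exists (- (a 0 0)^-1 *: y).
  rewrite -scalemxAl; apply: (scalerI a0); rewrite scalerA mulrN divff// scaleN1r.
  by apply/eqP; rewrite -addr_eq0 ayM.
move: ayM; rewrite a0 scale0r add0r => yM.
have -> : y = 0 by apply: (row_free_inj Mf); rewrite yM mul0mx.
by rewrite raddf0 row_mx0.
Qed.

Lemma minor_plucker_bound (R : realType) l n (M : 'M[R]_(l, n))
    (X : plucker_index n l -> int) (D : R) :
  0 <= D -> (forall I, (X I)%:~R = minor (val I) M) -> (forall I, `|(X I)%:~R| <= D) ->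
  forall f : 'I_l -> 'I_n, exists z : int, minor f M = z%:~R /\ `|minor f M| <= D.
Proof.
move=> D0 XM XD f; have [m0|[I [s Is]]] := minor_sort f.
  by exists 0; rewrite m0 normr0.
exists ((-1) ^+ s * X I); rewrite Is -XM rmorphM /= rmorph_sign; split=> //.
by rewrite normrM normr_sign mul1r.
Qed.

Lemma ler_root (R : realType) (x y : R) m : (0 < m)%N -> 0 <= x -> 0 < y ->
  y * x ^+ m <= 2 ^+ m -> x <= 2 * y `^ (- m%:R^-1).
Proof.
move=> m0 x0 y0 xy; rewrite -(@ler_pXn2r _ m)// ?nnegrE// ?mulr_ge0 ?powR_ge0//.
rewrite exprMn -(powR_mulrn _ (powR_ge0 _ _)) -powRrM mulNr mulVf ?pnatr_eq0 -?lt0n//.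
by rewrite powRN powRr1 ?(ltW y0)// ler_pdivlMr// mulrC.
Qed.

Lemma going_up_one (R : realType) n l : (0 < l)%N -> (l < n)%N -> exists2 c : R, 0 < c &
  forall C : {vspace 'rV[R]_n}, rational_subspaces l C ->
  exists B : {vspace 'rV[R]_n}, [/\ rational_subspaces l.+1 B, (C <= B)%VS &
    height B <= c * height C `^ ((n - l.+1)%:R / (n - l)%:R)].
Proof.
(* Number of coordinates, times [l.+1] terms in the expansion of each, times the 2 from the short
   vector; the summand 1 makes the constant positive. *)
move=> l0 ln; exists (#|{: plucker_index n l.+1}|%:R * (l.+1%:R * 2) + 1).
  by rewrite ltr_wpDl// !mulr_ge0.
move=> C rC; have [X [XC Xc hX]] := heightP l0 rC.
have [I1 X1] := plucker_neq0 XC.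
pose I0 := [arg max_(I > I1) `|X I|%N]%O.
have XI0 I : (`|X I| <= `|X I0|)%N.
  by rewrite /I0; case: Order.TotalTheory.arg_maxP => // J _; apply.
set D := `|X I0|%N in XI0.
have D0 : (0 < D)%N by apply: leq_trans (XI0 I1); rewrite absz_gt0 -(intr_eq0 R).
have X0 : (X I0)%:~R != 0 :> R by rewrite intr_eq0 -absz_gt0.
have XD I : `|(X I)%:~R| <= D%:R :> R by rewrite -intr_norm ler_nat; exact: XI0.
have [E [Ef CE E1 XE]] := normalized_basis XC X0.
(* Entries of [E] are signed minors of [E], and [D] times such a minor is a coordinate of [X] up to
   sign. *)
have DE i k : exists z : int, D%:R * E i k = z%:~R.
  have DX : D%:R = (-1) ^+ (X I0 < 0)%R * (X I0)%:~R :> R.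
    by rewrite -[D%:R]/(D%:Z%:~R) abszE normrEsign rmorphM /= rmorph_sign.
  rewrite -(minor_replace_column _ _ E1).
  have [m0|[I [s Is]]] := minor_sort (fun r => if r == i then k else val I0 r).
    by exists 0; rewrite m0 mulr0.
  exists ((-1) ^+ (X I0 < 0)%R * (-1) ^+ s * X I).
  by rewrite Is DX !intrM !intr_sign (XE I) mulrACA.
(* The minors of the integral basis [Q E] form an integral multiple [z X]; comparing them at [I0]
   gives [det Q = z * X I0]. *)
have minD (Q : 'M[int]_l) (N : 'M[int]_(l, n)) : \det Q != 0 ->
  map_mx intr Q *m E = map_mx intr N -> (D <= `|\det Q|)%N.
  move=> Q0 QN.
  have Qu : map_mx intr Q \in (unitmx : {pred 'M[R]_l}).
    by rewrite unitmxE unitfE det_map_mx intr_eq0.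
  have NC : plucker_coordinates C (fun I => (minor (val I) N)%:~R : R).
    apply/plucker_coordinatesE; exists (map_mx intr Q *m E); split.
    - by rewrite /row_free mxrankMfree// mxrank_unit.
    - by rewrite rowspan_mulmx.
    - by move=> I; rewrite QN minor_map.
  have [a a0 NX] := plucker_proportional XC NC.
  have [z az] := coprime_multiple_int Xc NX.
  have := NX I0; rewrite -minor_map -QN minor_mulmx /minor E1 det1 mulr1 det_map_mx az.
  rewrite -rmorphM /= => /eqP; rewrite eqr_int => /eqP Qz.
  rewrite Qz abszM leq_pmull// absz_gt0.
  by apply: contra_neq Q0 => z0; rewrite Qz z0 mul0r.
have [v [w [w0 wI vw wD]]] := exists_short_vector D0 ln E1 DE minD.
have [M [Mf CM XM]] := (plucker_coordinatesE _ _).1 XC.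
(* Otherwise [w] would lie in [C] and vanish on the pivot columns, hence be 0. *)
have vC : map_mx intr v \notin C.
  apply: contra_neqN w0 => vC; apply: (rowspan_pivot E1) => //.
  by rewrite -CE -[w](addKr (map_mx intr v)) addrC rpredB// CE.
exists (rowspan (map_mx intr v) + C)%VS; split; last 1 first.
- have [x vwx] : exists x, map_mx intr v = - w + x *m M.
    have /rowspanP[x xM] : map_mx intr v + w \in rowspan M by rewrite -CM CE.
    by exists x; rewrite -xM addrCA addNr addr0.
  have wD' k : `|w 0 k| <= 2 * D%:R `^ (- (n - l)%:R^-1).
    by apply: ler_root; rewrite ?subn_gt0 ?ltr0n.
  have minorM := minor_plucker_bound (ler0n R D) XM XD.
  (* Computed with [v] the minors are integral; computed with [-w] in its place they are small. *)
  have mg g : exists2 Y : int, minor g (col_mx (map_mx intr v) M) = Y%:~R &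
      `|Y%:~R| <= l.+1%:R * (2 * D%:R `^ (- (n - l)%:R^-1) * D%:R) :> R.
    have /intrP[z zE] : minor g (col_mx (map_mx intr v) M) \is a Num.int.
      rewrite minor_col_mx; apply: rpred_sum => j _.
      have [z [-> _]] := minorM (fun i => g (lift j i)).
      by rewrite !rpredM ?rpredX ?rpredN1 ?mxE ?intr_int.
    exists z => //; rewrite -zE vwx minor_col_mx_addr minor_col_mx.
    apply: (le_trans (ler_norm_sum _ _ _)).
    rewrite -[in leRHS](card_ord l.+1) mulr_natl -sumr_const; apply: ler_sum => j _.
    rewrite !normrM normr_sign mul1r mxE normrN ler_pM//.
    by have [z1 [_ zD]] := minorM (fun i => g (lift j i)).
  pose Y (I : plucker_index n l.+1) := projT1 (cid2 (mg (val I))).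
  have YB : @plucker_coordinates _ _ l.+1 (rowspan (map_mx intr v) + C)%VS (fun I => (Y I)%:~R : R).
    apply/plucker_coordinatesE; exists (col_mx (map_mx intr v) M); split.
    + by apply: row_free_col_mx; rewrite -?CM.
    + by rewrite (@rowspan_col_mx _ 1 l) -CM.
    + by move=> I; rewrite /Y; case: cid2.
  apply: (le_trans (height_le_int_norm YB)).
  apply: (le_trans (int_norm_le (D := l.+1%:R * (2 * D%:R `^ (- (n - l)%:R^-1) * D%:R)) _ _)).
  + by move=> I; rewrite /Y; case: cid2.
  + by rewrite !mulr_ge0// powR_ge0.
  rewrite -!mulrA.
  (* The exponent is [1 - 1 / (n - l)]. *)
  have -> : D%:R `^ (- (n - l)%:R^-1) * D%:R = D%:R `^ ((n - l.+1)%:R / (n - l)%:R) :> R.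
    rewrite -[X in _ * X](@powRr1 _ D%:R)// -powRD; last by rewrite pnatr_eq0 -lt0n D0 implybT.
    have nl0 : (n - l)%:R != 0 :> R by rewrite pnatr_eq0 -lt0n subn_gt0.
    have -> : (n - l.+1)%:R = (n - l)%:R - 1 :> R by apply/eqP; rewrite eq_sym subr_eq natr1 -subSn.
    by rewrite mulrBl mul1r divff// addrC.
  have DH : D%:R <= height C by rewrite hX; exact: (int_norm_ge R X I0).
  apply: (@le_trans _ _ (#|{: plucker_index n l.+1}|%:R *
      (l.+1%:R * (2 * height C `^ ((n - l.+1)%:R / (n - l)%:R))))).
    rewrite !ler_wpM2l// ge0_ler_powR ?nnegrE ?divr_ge0//.
    by rewrite (le_trans _ DH).
  move: (height C `^ _) (powR_ge0 (height C) ((n - l.+1)%:R / (n - l)%:R)) => h h0.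
  by rewrite [leRHS]mulrDl mul1r !mulrA lerDl.
- have [N [Nf CN]] := (rational_subspacesP _ _).1 rC.
  apply/rational_subspacesP; exists (col_mx v N).
  rewrite (@map_col_mx _ _ _ 1 l) (@rowspan_col_mx _ 1 l) -CN; split=> //.
  by apply: row_free_col_mx; rewrite -?CN.
- by rewrite addvSr.
Qed.

(** Dimensions are raised one at a time, and the exponents telescope: [(n-m)/(n-l) * (n-m-1)/(n-m) =
    (n-m-1)/(n-l)]. *)
Lemma going_up (R : realType) n l e : (0 < l)%N -> (l <= e)%N -> (e < n)%N ->
  exists2 c : R, 0 < c &
  forall C : {vspace 'rV[R]_n}, rational_subspaces l C ->
  exists B : {vspace 'rV[R]_n}, [/\ rational_subspaces e B, (C <= B)%VS &
    height B <= c * height C `^ ((n - e)%:R / (n - l)%:R)].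
Proof.
move=> l0 le; rewrite -(subnKC le); elim: (e - l)%N => {e le} [|k IHk] ln.
  rewrite addn0 in ln *; exists 1 => // C rC; exists C; split=> //.
  rewrite mul1r divff ?powRr1//; last by rewrite pnatr_eq0 -lt0n subn_gt0.
  by rewrite (le_trans ler01)// (height_ge1 l0 rC).
rewrite addnS in ln *; have [c c0 cC] := IHk (ltnW ln).
have lk0 : (0 < l + k)%N by rewrite ltn_addr.
have [c' c'0 cC'] := going_up_one R lk0 (ltnW ln).
exists (c' * c `^ ((n - (l + k).+1)%:R / (n - (l + k))%:R)).
  by rewrite mulr_gt0// powR_gt0.
move=> C rC; have [B [rB CB hB]] := cC _ rC; have [B' [rB' BB' hB']] := cC' _ rB.
exists B'; split=> //; first exact: subv_trans BB'.
apply: (le_trans hB'); rewrite -mulrA ler_pM2l//.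
have -> : (n - (l + k).+1)%:R / (n - l)%:R =
    (n - (l + k))%:R / (n - l)%:R * ((n - (l + k).+1)%:R / (n - (l + k))%:R) :> R.
  by rewrite [RHS]mulrC mulrA divfK// pnatr_eq0 -lt0n subn_gt0 ltnW.
rewrite (powRrM (height C)) -powRM ?powR_ge0 ?(ltW c0)// ge0_ler_powR ?nnegrE ?divr_ge0//.
  by rewrite (le_trans ler01)// (height_ge1 lk0 rB).
by rewrite mulr_ge0 ?powR_ge0 ?(ltW c0).
Qed.

(** * Canonical angles *)

Section Dot.
Variables (R : realType) (n : nat).
Implicit Types (X Y Z : 'rV[R]_n) (A B C : {vspace 'rV[R]_n}).

Lemma dotvC X Y : dotv X Y = dotv Y X.
Proof. by apply: eq_bigr => i _; rewrite mulrC. Qed.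

Lemma dotvDl X Y Z : dotv (X + Y) Z = dotv X Z + dotv Y Z.
Proof. by rewrite -big_split; apply: eq_bigr => i _; rewrite mxE mulrDl. Qed.

Lemma dotvZl a X Y : dotv (a *: X) Y = a * dotv X Y.
Proof. by rewrite mulr_sumr; apply: eq_bigr => i _; rewrite mxE mulrA. Qed.

Lemma dotvNl X Y : dotv (- X) Y = - dotv X Y.
Proof. by rewrite -scaleN1r dotvZl mulN1r. Qed.

Lemma dotvDr X Y Z : dotv X (Y + Z) = dotv X Y + dotv X Z.
Proof. by rewrite dotvC dotvDl !(dotvC X). Qed.

Lemma dotvZr a X Y : dotv X (a *: Y) = a * dotv X Y.
Proof. by rewrite dotvC dotvZl dotvC. Qed.

Lemma dotvNr X Y : dotv X (- Y) = - dotv X Y.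
Proof. by rewrite dotvC dotvNl dotvC. Qed.

Lemma dot0v X : dotv 0 X = 0.
Proof. by rewrite -(scale0r 0) dotvZl mul0r. Qed.

Definition dotvE := (dotvDl, dotvDr, dotvNl, dotvNr, dotvZl, dotvZr).

Lemma dotvv_ge0 X : 0 <= dotv X X.
Proof. by apply: sumr_ge0 => i _; rewrite -expr2 sqr_ge0. Qed.

Lemma dotvv_eq0 X : (dotv X X == 0) = (X == 0).
Proof.
apply/idP/eqP => [|->]; last by rewrite dot0v.
rewrite psumr_eq0 => [/allP X0|i _]; last by rewrite -expr2 sqr_ge0.
apply/rowP => i; rewrite mxE.
by have := X0 i (mem_index_enum _); rewrite -expr2 sqrf_eq0 => /eqP.
Qed.

Lemma dotvv_gt0 X : (0 < dotv X X) = (X != 0).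
Proof. by rewrite lt_def dotvv_ge0 dotvv_eq0 andbT. Qed.

Lemma dotv_span s X : (forall Z, Z \in s -> dotv X Z = 0) -> forall Z, Z \in span s -> dotv X Z = 0.
Proof.
move=> Xs Z; rewrite -[s]in_tupleE => /coord_span ->; rewrite dotvC.
elim/big_ind: _ => [|U V|i _]; first by rewrite dot0v.
  by rewrite dotvDl => -> ->; rewrite addr0.
by rewrite dotvZl dotvC Xs ?mulr0// mem_nth.
Qed.

Lemma enorm_sqr X : enorm X ^+ 2 = dotv X X.
Proof. by rewrite sqr_sqrtr ?dotvv_ge0. Qed.

Lemma enorm1P X : enorm X = 1 <-> dotv X X = 1.
Proof.
split=> X1; first by rewrite -enorm_sqr X1 expr1n.
by rewrite /enorm X1 sqrtr1.
Qed.

(** Lagrange's identity; the sum over [i < k] is half of the sum over all pairs, since the summand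
    is symmetric and vanishes on the diagonal. *)
Lemma wedge_norm_sqr X Y : wedge_norm X Y ^+ 2 = dotv X X * dotv Y Y - dotv X Y ^+ 2.
Proof.
pose F i k := (X 0 i * Y 0 k - X 0 k * Y 0 i) ^+ 2.
have F0 i k : 0 <= F i k by exact: sqr_ge0.
rewrite sqr_sqrtr; last by do 2![apply: sumr_ge0 => ? _]; exact: sqr_ge0.
have sym : \sum_(i < n) \sum_(k < n | (k < i)%N) F i k =
    \sum_(i < n) \sum_(k < n | (i < k)%N) F i k.
  rewrite (exchange_big_dep predT)//=; apply: eq_bigr => i _; apply: eq_bigr => k _.
  by rewrite /F; ring.
have tot : \sum_(i < n) \sum_(k < n) F i k = 2 * (\sum_(i < n) \sum_(k < n | (i < k)%N) F i k).
  rewrite mulr2n mulrDl !mul1r -[in X in _ = X + _]sym -big_split; apply: eq_bigr => i _.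
  rewrite (bigID (fun k : 'I_n => (k < i)%N))/=; congr (_ + _).
  rewrite (bigD1 i) ?ltnn//= [F i i]expr2 subrr mul0r add0r; apply: eq_bigl => k.
  by rewrite -leqNgt ltn_neqAle andbC eq_sym.
have two : 2 != 0 :> R by rewrite pnatr_eq0.
apply: (mulfI two); rewrite -tot mulrBr.
have -> : 2 * (dotv X X * dotv Y Y) =
    \sum_(i < n) \sum_(k < n) (X 0 i ^+ 2 * Y 0 k ^+ 2 + X 0 k ^+ 2 * Y 0 i ^+ 2).
  have XY : dotv X X * dotv Y Y = \sum_(i < n) \sum_(k < n) X 0 i ^+ 2 * Y 0 k ^+ 2.
    rewrite /dotv mulr_suml; apply: eq_bigr => i _; rewrite mulr_sumr.
    by apply: eq_bigr => k _; rewrite !expr2.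
  rewrite mulr2n mulrDl !mul1r {1}XY XY [X in _ + X]exchange_big -big_split.
  by apply: eq_bigr => i _; rewrite -big_split.
have -> : 2 * dotv X Y ^+ 2 = \sum_(i < n) \sum_(k < n) (2 * (X 0 i * Y 0 i) * (X 0 k * Y 0 k)).
  rewrite expr2 {1}/dotv mulr_suml mulr_sumr; apply: eq_bigr => i _.
  by rewrite /dotv !mulr_sumr; apply: eq_bigr => k _; rewrite mulrA.
rewrite -sumrB; apply: eq_bigr => i _; rewrite -sumrB; apply: eq_bigr => k _.
by rewrite /F; ring.
Qed.

Lemma psiC X Y : psi X Y = psi Y X.
Proof.
have wC : wedge_norm X Y = wedge_norm Y X.
  apply/eqP; rewrite -(@eqrXn2 _ 2) ?sqrtr_ge0//.
  by rewrite !wedge_norm_sqr (dotvC X Y) [dotv Y Y * _]mulrC.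
by rewrite /psi wC mulrC [RHS]mulrC [enorm X * _]mulrC.
Qed.

Lemma psi_ge0 X Y : 0 <= psi X Y.
Proof. by rewrite divr_ge0 ?mulr_ge0 ?sqrtr_ge0. Qed.

Lemma psi_sqr X Y : X != 0 -> Y != 0 ->
  psi X Y ^+ 2 = 1 - dotv X Y ^+ 2 / (dotv X X * dotv Y Y).
Proof.
rewrite -!dotvv_gt0 => X0 Y0; rewrite /psi expr_div_n exprMn !enorm_sqr wedge_norm_sqr.
by rewrite mulrBl divff// mulf_neq0// gt_eqF.
Qed.

Lemma unit_neq0 X : enorm X = 1 -> X != 0.
Proof. by move/enorm1P => X1; rewrite -dotvv_gt0 X1. Qed.

Lemma psi_unit X Y : enorm X = 1 -> enorm Y = 1 -> psi X Y ^+ 2 = 1 - dotv X Y ^+ 2.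
Proof.
move=> X1 Y1; rewrite psi_sqr ?unit_neq0//.
by rewrite !(enorm1P _).1// mulr1 divr1.
Qed.

Lemma psi_le_unit X Y X' Y' : enorm X = 1 -> enorm Y = 1 -> enorm X' = 1 -> enorm Y' = 1 ->
  (psi X Y <= psi X' Y') = (dotv X' Y' ^+ 2 <= dotv X Y ^+ 2).
Proof.
move=> X1 Y1 X'1 Y'1; rewrite -(@ler_pXn2r _ 2) ?nnegrE ?psi_ge0//.
by rewrite !psi_unit// lerD2l lerN2.
Qed.

Lemma psi_le_dotv X Y X' Y' : enorm X = 1 -> enorm Y = 1 -> X' != 0 -> Y' != 0 ->
  (psi X Y <= psi X' Y') = (dotv X' Y' ^+ 2 <= dotv X Y ^+ 2 * (dotv X' X' * dotv Y' Y')).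
Proof.
move=> X1 Y1 X'0 Y'0; rewrite -(@ler_pXn2r _ 2) ?nnegrE ?psi_ge0//.
by rewrite psi_unit// psi_sqr// lerD2l lerN2 ler_pdivrMr// mulr_gt0 ?dotvv_gt0.
Qed.

(** The minimality of the sine as a homogeneous bound on the cosine, valid for zero vectors too, so
    that later arguments need no normalization. *)
Lemma min_pair_dotv (U V : set 'rV[R]_n) X Y : min_pair U V X Y -> forall X' Y', U X' -> V Y' ->
  dotv X' Y' ^+ 2 <= dotv X Y ^+ 2 * (dotv X' X' * dotv Y' Y').
Proof.
move=> [[UX X1] [VY Y1] mXY] X' Y' UX' VY'.
have [->|X'0] := eqVneq X' 0; first by rewrite !dot0v expr0n/= !(mul0r, mulr0).
have [->|Y'0] := eqVneq Y' 0; first by rewrite dotvC !dot0v expr0n/= !(mul0r, mulr0).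
by rewrite -psi_le_dotv// mXY.
Qed.

Lemma min_pairC (U V : set 'rV[R]_n) X Y : min_pair U V X Y -> min_pair V U Y X.
Proof. by move=> [UX VY m]; split=> // X' Y' *; rewrite psiC (psiC X') m. Qed.

(* The vector [qcY + mY'] is a multiple of the orthogonal projection of [X] to
   the span of [Y] and [Y'], with [q = |Y'|^2], [c = X.Y], [m = X.Y']. *)
Lemma min_pair_orthogonal (U V : set 'rV[R]_n) X Y Y' :
  (forall a b Z Z', V Z -> V Z' -> V (a *: Z + b *: Z')) ->
  min_pair U V X Y -> V Y' -> dotv Y Y' = 0 -> dotv X Y' = 0.
Proof.
move=> Vlin mXY VY' YY'; have [[UX /enorm1P X1] [VY /enorm1P Y1] _] := mXY.
set c := dotv X Y; set m := dotv X Y'; set q := dotv Y' Y'.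
have := min_pair_dotv mXY UX (Vlin (q * c) m _ _ VY VY').
rewrite !dotvE (dotvC Y' Y) YY' X1 Y1 -/c -/m -/q => H.
have q0 : 0 <= q by exact: dotvv_ge0.
have : m ^+ 2 * (q * c ^+ 2 + m ^+ 2) <= 0 by nra.
have : 0 <= q * c ^+ 2 by rewrite mulr_ge0 ?sqr_ge0.
move=> qc H2; have : m ^+ 2 <= 0 by have := sqr_ge0 m; nra.
by rewrite exprn_even_le0 //= => /eqP.
Qed.

Lemma ortho_compl_lin s A a b X Y :
  ortho_compl s A X -> ortho_compl s A Y -> ortho_compl s A (a *: X + b *: Y).
Proof.
move=> [XA Xs] [YA Ys]; split; first by rewrite rpredD ?rpredZ.
by move=> Z Zs; rewrite !dotvE Xs// Ys// !mulr0 addr0.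
Qed.

Lemma canonical_pairsC A B Xs Ys : canonical_pairs A B Xs Ys -> canonical_pairs B A Ys Xs.
Proof.
elim=> [|{}Xs {}Ys X Y _ IH m]; first exact: CanonicalNil.
by apply: CanonicalRcons => //; exact: min_pairC.
Qed.

Lemma span_rcons (s : seq 'rV[R]_n) X : span (rcons s X) = (span s + <[X]>)%VS.
Proof. by rewrite -cats1 span_cat span_seq1. Qed.

Lemma ortho_compl_rcons s A X Z : ortho_compl (rcons s X) A Z <-> ortho_compl s A Z /\ dotv Z X = 0.
Proof.
split=> [[ZA Zs]|[[ZA Zs] ZX]].
  split; last by apply: Zs; rewrite memv_span// mem_rcons mem_head.
  by split=> // W Ws; apply: Zs; rewrite span_rcons; exact: (subvP (addvSl _ _)).
split=> // W; rewrite span_rcons => /memv_addP[W1 W1s [_ /vlineP[k ->] ->]].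
by rewrite !dotvE Zs// ZX mulr0 addr0.
Qed.

Lemma canonical_size A B Xs Ys : canonical_pairs A B Xs Ys -> size Xs = size Ys.
Proof. by elim=> // {}Xs {}Ys X Y _ IH _; rewrite !size_rcons IH. Qed.

Lemma canonical_sub A B Xs Ys : canonical_pairs A B Xs Ys -> (span Xs <= A)%VS.
Proof.
elim=> [|{}Xs {}Ys X Y _ IH [[[XA _] _] _ _]]; first by rewrite span_nil sub0v.
by rewrite span_rcons subv_add IH.
Qed.

Lemma canonical_free A B Xs Ys : canonical_pairs A B Xs Ys -> free Xs.
Proof.
elim=> [|{}Xs {}Ys X Y _ IH [[[XA Xo] /enorm1P X1] _ _]]; first exact: nil_free.
rewrite (perm_free (_ : perm_eq _ (X :: Xs))) ?perm_rcons// free_cons IH andbT.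
by apply/negP => /Xo; rewrite X1 => /eqP; rewrite oner_eq0.
Qed.

Lemma canonical_proj A B Xs Ys : canonical_pairs A B Xs Ys ->
  forall x, exists2 z, z \in span Xs & forall Z, Z \in span Xs -> dotv (x - z) Z = 0.
Proof.
elim=> [|{}Xs {}Ys X Y _ IH [[[XA Xo] /enorm1P X1] _ _]] x.
  by exists 0; rewrite ?mem0v// => Z; rewrite span_nil memv0 => /eqP ->; rewrite dotvC dot0v.
have [z zs zo] := IH x; exists (z + dotv (x - z) X *: X).
  by rewrite span_rcons memv_add// memvZ// memv_line.
move=> Z; rewrite span_rcons => /memv_addP[W Ws [_ /vlineP[k ->] ->]].
have := zo _ Ws; rewrite !dotvE X1 (Xo _ Ws); lra.
Qed.

(** By induction on the pairs: since [(X, Y)] is extremal, a vector still available on the side of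
    [A] and orthogonal to [X] is orthogonal to [Y] as well. *)
Lemma canonical_orthogonal A B Xs Ys x : canonical_pairs A B Xs Ys ->
  ortho_compl Xs A x -> forall Z, Z \in span Ys -> dotv x Z = 0.
Proof.
move=> cp; elim: cp x => [|{}Xs {}Ys X Y _ IH m] x.
  by move=> _ Z; rewrite span_nil memv0 => /eqP ->; rewrite dotvC dot0v.
move=> /ortho_compl_rcons[xo xX] Z; rewrite span_rcons.
move=> /memv_addP[W Ws [_ /vlineP[k ->] ->]]; rewrite !dotvE (IH _ xo _ Ws) add0r.
rewrite [dotv x Y]dotvC (min_pair_orthogonal _ (min_pairC m) xo) ?mulr0// 1?dotvC//.
exact: ortho_compl_lin.
Qed.

(** The admissible sets shrink, so [(X', Y')] was a candidate when each earlier pair was chosen. *)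
Lemma canonical_cos_decreasing A B Xs Ys X' Y' : canonical_pairs A B Xs Ys ->
  ortho_compl Xs A X' -> ortho_compl Ys B Y' -> forall p, p \in zip Xs Ys ->
  dotv X' Y' ^+ 2 <= dotv p.1 p.2 ^+ 2 * (dotv X' X' * dotv Y' Y').
Proof.
elim=> // {}Xs {}Ys X Y cp IH m /ortho_compl_rcons[X'o _] /ortho_compl_rcons[Y'o _] p.
rewrite zip_rcons ?(canonical_size cp)// mem_rcons inE => /orP[/eqP ->|]; last exact: IH.
exact: (min_pair_dotv m).
Qed.

(* [y] is the orthogonal projection of [x] to [B]. *)
Lemma canonical_span A B Xs Ys k : canonical_pairs A B Xs Ys ->
  (forall p, p \in zip Xs Ys -> k <= dotv p.1 p.2 ^+ 2) ->
  forall x, x \in span Xs -> exists2 y, y \in span Ys &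
    dotv x y = dotv y y /\ k * dotv x x <= dotv y y.
Proof.
elim=> [|{}Xs {}Ys X Y cp IH m] kp x.
  rewrite span_nil memv0 => /eqP ->; exists 0; rewrite ?mem0v// dot0v mulr0.
  by split.
rewrite !span_rcons => /memv_addP[x0 x0s [_ /vlineP[a ->] ->]].
have [|y0 y0s [xy xx]] := IH _ _ x0s.
  by move=> p pz; apply: kp; rewrite zip_rcons ?(canonical_size cp)// mem_rcons inE pz orbT.
have [[Xo /enorm1P X1] [Yo /enorm1P Y1] _] := m.
have kc : k <= dotv X Y ^+ 2.
  by apply: (kp (X, Y)); rewrite zip_rcons ?(canonical_size cp)// mem_rcons mem_head.
exists (y0 + (a * dotv X Y) *: Y); first by rewrite memv_add// memvZ// memv_line.
(* All mixed scalar products vanish, so both claims split into those for [x0] and for [a *: X]. *)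
have Xy0 : dotv X y0 = 0 by apply: (canonical_orthogonal cp Xo).
have x0X : dotv x0 X = 0 by rewrite dotvC; apply: Xo.2.
have y0Y : dotv y0 Y = 0 by rewrite dotvC; apply: Yo.2.
have x0Y : dotv x0 Y = 0.
  by rewrite dotvC (canonical_orthogonal (canonical_pairsC cp) Yo).
rewrite !dotvE (dotvC X x0) (dotvC Y y0) Xy0 x0X y0Y x0Y X1 Y1 -xy.
split; first by ring.
rewrite xy; have a0 : 0 <= a ^+ 2 := sqr_ge0 a. nra.
Qed.
End Dot.

(** * The min-max principle for canonical angles *)

Section Monotonicity.
Variables (R : realType) (n : nat).
Implicit Types (X Y Z : 'rV[R]_n) (A B C : {vspace 'rV[R]_n}).

(** Orthogonality to [s] imposes [size s] linear conditions on a space of larger dimension. *)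
Lemma exists_orthogonal A (s : seq 'rV[R]_n) : (size s < \dim A)%N ->
  exists x, [/\ x \in A, x != 0 & forall Z, Z \in span s -> dotv x Z = 0].
Proof.
move=> sA; have Ab := vbasisP A.
pose M := tuple_mx (vbasis A); pose N := tuple_mx (in_tuple s).
have /rowV0Pn[x /sub_kermxP xK x0] : kermx (M *m N^T) != 0.
  rewrite kermx_eq0 /row_free neq_ltn (leq_ltn_trans _ sA)//.
  by rewrite (leq_trans (mxrankM_maxr _ _))// rank_leq_col.
exists (x *m M); split.
- by have /vspaceP -> := rowspan_tuple_mx Ab; apply/rowspanP; exists x.
- by apply: contra_neq x0 => xM; apply: (row_free_inj (tuple_mx_free Ab)); rewrite xM mul0mx.
apply: dotv_span => Z /(nthP 0)[i si <-].
have /rowP/(_ (Ordinal si)) := xK; rewrite mulmxA mxE [RHS]mxE => xi; rewrite -[RHS]xi.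
by apply: eq_bigr => k _; rewrite [N^T _ _]mxE [N _ _]mxE (tnth_nth 0).
Qed.

(** Subtract from [y] its projection to the span of [Ys]: this span is orthogonal to [x], and the
    norm cannot grow. *)
Lemma canonical_ortho_projection A B Xs Ys x y : canonical_pairs A B Xs Ys ->
  ortho_compl Xs A x -> y \in B ->
  exists2 y', ortho_compl Ys B y' & dotv x y' = dotv x y /\ dotv y' y' <= dotv y y.
Proof.
move=> cp xo yB; have cpC := canonical_pairsC cp.
have [z zs zo] := canonical_proj cpC y; exists (y - z).
  by split=> //; rewrite rpredB//; apply: (subvP (canonical_sub cpC)).
have xz := canonical_orthogonal cp xo zs.
have yz := zo _ zs; rewrite !dotvE in yz.
have zz := dotvv_ge0 z.
by rewrite !dotvE xz subr0 (dotvC z y); split=> //; lra.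
Qed.

(** A vector [x] is taken in the span of the first [j] canonical vectors of [A] relative to [C], and
    its projection [y] to [C] satisfies [|y|^2 >= k |x|^2]. If [x] is also orthogonal to the first
    [j - 1] canonical vectors relative to [B], it competes in the [j]-th minimum there, which bounds
    that cosine below. *)
Lemma is_psi_le j A B C s t : (0 < j)%N -> (C <= B)%VS ->
  is_psi_ j A C s -> is_psi_ j A B t -> t <= s.
Proof.
move=> j0 CB [Xs0 [Ys0 [cp sXs ->]]] [Xs1 [Ys1 [cp' sXs' ->]]].
case: cp sXs => [/esym j00|Xs Ys X Y cp m]; first by rewrite j00 in j0.
case: cp' sXs' => [/esym j00|Xs' Ys' X' Y' cp' m']; first by rewrite j00 in j0.
rewrite !size_rcons !last_rcons => sXs' sXs.
have [[Xo X1] [Yo Y1] _] := m; have [[X'o X'1] [Y'o Y'1] _] := m'.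
rewrite psi_le_unit//; set k := dotv X Y ^+ 2.
have cpr := CanonicalRcons cp m.
(* Dimension count: [j] independent vectors against [j - 1] conditions. *)
have [x [xs x0 xo]] : exists x, [/\ x \in span (rcons Xs X), x != 0 &
    forall Z, Z \in span Xs' -> dotv x Z = 0].
  apply: exists_orthogonal; have /eqP -> := canonical_free cpr.
  by rewrite size_rcons sXs -sXs'.
have [|y ys [xy kxx]] := canonical_span (k := k) cpr _ xs.
  move=> p; rewrite zip_rcons ?(canonical_size cp)// mem_rcons inE => /orP[/eqP -> //|pz].
  have := canonical_cos_decreasing cp Xo Yo pz.
  by rewrite ((enorm1P X).1 X1) ((enorm1P Y).1 Y1) !mulr1.
have xA : ortho_compl Xs' A x by split=> //; apply: (subvP (canonical_sub cpr)).
have yB : y \in B by apply: (subvP CB); apply: (subvP (canonical_sub (canonical_pairsC cpr))).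
have [y' y'o [xy' y'y]] := canonical_ortho_projection cp' xA yB.
have := min_pair_dotv m' xA y'o; rewrite xy' xy.
set c := dotv X' Y' ^+ 2; set yy := dotv y y; set xx := dotv x x in kxx *.
have xx0 : 0 < xx by rewrite dotvv_gt0.
have y'0 := dotvv_ge0 y'; have c0 : 0 <= c := sqr_ge0 _.
(* For [k = 0] the bound is clear; for [k > 0] the vector [y] is nonzero and its squared norm can be
   cancelled. *)
have [->|k0] := eqVneq k 0; first by [].
have {}k0 : 0 < k by rewrite lt_def k0 sqr_ge0.
have yy0 : 0 < yy by apply: lt_le_trans kxx; rewrite mulr_gt0.
rewrite -/yy in y'y kxx => H.
have H1 : yy * yy <= c * xx * yy 
  by rewrite -expr2 (le_trans H)// -mulrA; do 2![apply: ler_wpM2l => //]; exact: ltW.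
have H2 : yy <= c * xx by rewrite -(ler_pM2r yy0).
by rewrite -(ler_pM2r xx0) (le_trans kxx).
Qed.

(** If the [j]-th sine were 0, the first [j] cosines would all be 1 up to sign. Each vector in the
    span of the first [j] vectors of [A] would then equal its projection to [B], giving [j]
    dimensions in the intersection. *)
Lemma is_psi_gt0 j A B s : (0 < j)%N -> (\dim (A :&: B) < j)%N -> is_psi_ j A B s -> 0 < s.
Proof.
move=> j0 AB [Xs0 [Ys0 [cp sXs ->]]].
case: cp sXs => [/esym j00|Xs Ys X Y cp m]; first by rewrite j00 in j0.
rewrite size_rcons !last_rcons => sXs; rewrite lt_def psi_ge0 andbT.
apply/eqP => psi0; move: AB; apply/negP; rewrite -leqNgt.
have [[Xo X1] [Yo Y1] _] := m; have cpr := CanonicalRcons cp m.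
have c1 : dotv X Y ^+ 2 = 1.
  by have := psi_unit X1 Y1; rewrite psi0 expr0n/= => /eqP; rewrite eq_sym subr_eq0 => /eqP.
have <- : \dim (span (rcons Xs X)) = j by have /eqP -> := canonical_free cpr; rewrite size_rcons.
apply: dimvS; rewrite subv_cap (canonical_sub cpr)/=; apply/subvP => x xs.
have [|y ys [xy xx]] := canonical_span (k := 1) cpr _ xs.
  move=> p; rewrite zip_rcons ?(canonical_size cp)// mem_rcons inE => /orP[/eqP -> /=|pz].
    by rewrite c1.
  have := canonical_cos_decreasing cp Xo Yo pz.
  by rewrite ((enorm1P X).1 X1) ((enorm1P Y).1 Y1) !mulr1 c1.
have -> : x = y.
  apply/eqP; rewrite -subr_eq0 -dotvv_eq0 eq_le dotvv_ge0 andbT.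
  by rewrite !dotvE (dotvC y x) xy; lra.
exact: (subvP (canonical_sub (canonical_pairsC cpr))).
Qed.
End Monotonicity.

(** * Existence of canonical pairs by compactness *)

Section Existence.
Import numFieldNormedType.Exports.
Local Open Scope classical_set_scope.
Variables (R : realType) (n : nat).
Implicit Types (X Y Z : 'rV[R]_n) (A B C : {vspace 'rV[R]_n}).

Lemma continuous_dotv (T : topologicalType) (f g : T -> 'rV[R]_n) :
  continuous f -> continuous g -> continuous (fun t => dotv (f t) (g t)).
Proof.
move=> cf cg; have coord (h : T -> 'rV[R]_n) i : continuous h -> continuous (fun t => h t 0 i).
  
  move=> ch t; apply: (@continuous_comp _ _ _ h (fun v : 'rV[R]_n => v 0 i)); first exact: ch.
  exact: coord_continuous.
apply: continuous_big => [|i _ t]; first exact: add_continuous.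
by apply: continuousM; exact: coord.
Qed.

Lemma closed_preimage_dotv (f g : 'rV[R]_n -> 'rV[R]_n) (a : R) :
  continuous f -> continuous g -> closed [set X | dotv (f X) (g X) = a].
Proof.
move=> cf cg; have := (continuous_closedP _).1 (continuous_dotv cf cg) [set a].
by apply; exact: closed_eq.
Qed.

(** The columns of the cokernel matrix are orthogonal to [A] and cut it out. Thus [A] is an
    intersection of kernels of linear forms, hence closed. *)
Lemma mem_orthogonal_orthogonal A X :
  (forall Z, (forall Y, Y \in A -> dotv Y Z = 0) -> dotv X Z = 0) -> X \in A.
Proof.
move=> XA; pose M := tuple_mx (vbasis A).
have /vspaceP AM : A = rowspan M := rowspan_tuple_mx (vbasisP A).
have : (X <= M)%MS.
  rewrite submxE; apply/eqP/rowP => j; rewrite [RHS]mxE -(XA (col j (cokermx M))^T).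
    by rewrite mxE; apply: eq_bigr => k _; rewrite !mxE.
  move=> Y; rewrite AM => /rowspanP[y ->].
  transitivity ((y *m M *m cokermx M) 0 j); last by rewrite -mulmxA mulmx_coker mulmx0 mxE.
  by rewrite [RHS]mxE; apply: eq_bigr => k _; rewrite !mxE.
by case/submxP => y ->; rewrite AM; apply/rowspanP; exists y.
Qed.

Lemma ortho_compl_closed s A : closed (ortho_compl s A).
Proof.
have -> : ortho_compl s A =
    \bigcap_(Z in [set Z | (forall Y, Y \in A -> dotv Y Z = 0) \/ Z \in span s])
      [set X | dotv X Z = 0].
  apply/seteqP; split=> X.
    by move=> [XA Xs] Z [ZA|Zs]; [exact: ZA|exact: Xs].
  move=> XZ; split=> [|Z Zs]; last by apply: XZ; right.
  by apply: mem_orthogonal_orthogonal => Z ZA; apply: XZ; left.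
apply: closed_bigI => Z _.
by apply: (@closed_preimage_dotv id (fun=> Z)) => X; [exact: cvg_id|exact: cst_continuous].
Qed.

Lemma unit_compact s A : compact [set X | ortho_compl s A X /\ enorm X = 1].
Proof.
apply: bounded_closed_compact.
  (* Boundedness refers to the sup norm: a Euclidean unit vector has coordinates of absolute value
     at most 1. *)
  exists 1; split=> // M M1 X [_ /enorm1P X1].
  rewrite /Num.norm /= mx_normrE; apply: bigmax_le => [|[i k] _].
    by rewrite ltW// (lt_trans ltr01).
  apply: le_trans (ltW M1); rewrite [i]ord1 /= -(@expr_le1 _ 2)// real_normK ?num_real// -X1.
  by rewrite /dotv (bigD1 k)//= -expr2 lerDl sumr_ge0// => l _; rewrite -expr2 sqr_ge0.
have -> : [set X | ortho_compl s A X /\ enorm X = 1] = ortho_compl s A `&` [set X | dotv X X = 1].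
  by apply/seteqP; split=> X [XA /enorm1P X1].
apply: closedI; first exact: ortho_compl_closed.
by apply: (@closed_preimage_dotv id id) => X; exact: cvg_id.
Qed.

Lemma normalize X : X != 0 -> enorm ((enorm X)^-1 *: X) = 1.
Proof.
rewrite -dotvv_gt0 => X0; apply/enorm1P; rewrite !dotvE mulrA -expr2 exprVn enorm_sqr.
by rewrite mulVf// gt_eqF.
Qed.

(** The squared cosine attains a maximum on the product of the two unit spheres; homogeneity extends
    the comparison to all nonzero vectors. *)
Lemma min_pair_exists s t A B : (size s < \dim A)%N -> (size t < \dim B)%N ->
  exists X Y, min_pair (ortho_compl s A) (ortho_compl t B) X Y.
Proof.
have nz r D : (size r < \dim D)%N -> exists X, ortho_compl r D X /\ enorm X = 1.
  move=> /exists_orthogonal[x [xD x0 xr]]; exists ((enorm x)^-1 *: x); split; last exact: normalize.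
  by split=> [|Z Zr]; rewrite ?memvZ// dotvE xr ?mulr0.
move=> /nz[X0 sX0] /nz[Y0 tY0].
pose S := [set X | ortho_compl s A X /\ enorm X = 1] `*` [set Y | ortho_compl t B Y /\ enorm Y = 1].
have cf : continuous (fun p : 'rV[R]_n * 'rV[R]_n => dotv p.1 p.2 ^+ 2).
  have cd : continuous (fun p : 'rV[R]_n * 'rV[R]_n => dotv p.1 p.2).
    by apply: continuous_dotv => p; [exact: cvg_fst|exact: cvg_snd].
  by move=> p; apply: (continuousM (cd p) (cd p)).
have [||p] := @compact_EVT_max _ R (fun p => dotv p.1 p.2 ^+ 2) S _ _ (continuous_subspaceT cf).
- by exists (X0, Y0).
- by apply: compact_setX; exact: unit_compact.
rewrite inE => -[[pA p1] [pB p2]] pmax; exists p.1, p.2; split=> // X Y XA X0' YB Y0'.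
rewrite psi_le_dotv//.
have := pmax ((enorm X)^-1 *: X, (enorm Y)^-1 *: Y); rewrite inE => /(_ _)/=.
rewrite !dotvE mulrA exprMn -invfM exprVn exprMn !enorm_sqr ler_pdivrMl ?mulr_gt0 ?dotvv_gt0//.
rewrite [X in _ -> _ <= X]mulrC; apply.
by split; split=> /=; rewrite ?normalize//; [case: XA => XA Xs|case: YB => YB Ys];
  split=> [|Z Zr]; rewrite ?memvZ// dotvE ?Xs ?Ys ?mulr0.
Qed.

Lemma is_psi_exists j A B : (j <= \dim A)%N -> (j <= \dim B)%N -> exists s, is_psi_ j A B s.
Proof.
move=> jA jB; suff [Xs [Ys [cp sj]]] : exists Xs Ys, canonical_pairs A B Xs Ys /\ size Xs = j.
  by exists (psi (last 0 Xs) (last 0 Ys)), Xs, Ys.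
elim: j jA jB => [|j IH] jA jB; first by exists [::], [::]; split=> //; exact: CanonicalNil.
have [Xs [Ys [cp sj]]] := IH (ltnW jA) (ltnW jB).
have [||X [Y m]] := @min_pair_exists Xs Ys A B; rewrite -?(canonical_size cp) ?sj//.
by exists (rcons Xs X), (rcons Ys Y); split; [exact: CanonicalRcons|rewrite size_rcons sj].
Qed.
End Existence.

(** * Exponents *)

Section Transference.
Local Open Scope classical_set_scope.
Variables (R : realType) (n : nat).
Implicit Types (A B C : {vspace 'rV[R]_n}).

Lemma psi_P j A B : (j <= \dim A)%N -> (j <= \dim B)%N -> is_psi_ j A B (psi_ j A B).
Proof.
move=> jA jB; have [s sP] := is_psi_exists jA jB.
exact: (xgetPex _ (ex_intro _ s sP)).
Qed.

Lemma psi_antitone j A B C : (0 < j)%N -> (j <= \dim A)%N -> (j <= \dim C)%N -> (C <= B)%VS ->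
  psi_ j A B <= psi_ j A C.
Proof.
move=> j0 jA jC CB; apply: (is_psi_le j0 CB); apply: psi_P => //.
exact: leq_trans (dimvS CB).
Qed.

Lemma finite_positive_lower_bound (T : choiceType) (S : set T) (f : T -> R) :
  finite_set S -> (forall x, S x -> 0 < f x) -> exists2 m, 0 < m & forall x, S x -> m <= f x.
Proof.
case/finite_seqP => s ->; elim: s => [|x s IH] f0; first by exists 1.
have [m m0 mf] := IH (fun y ys => f0 y (mem_behead (s := x :: s) ys)).
exists (Num.min (f x) m) => [|y]; first by rewrite lt_min m0 f0//= mem_head.
by rewrite /= inE => /orP[/eqP ->|ys]; rewrite ge_min ?lexx// mf ?orbT.
Qed.

Definition approximants A e j (b : R) : set {vspace 'rV[R]_n} :=
  [set B | rational_subspaces e B /\ psi_ j A B <= height B `^ (- b)].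

(** A rational [C] of dimension [l] lies in a rational [B] of dimension [e], which already meets [A]
    in dimension less than [j]. *)
Lemma irrational_antitone d e j l : (0 < l)%N -> (l <= e)%N -> (e < n)%N ->
  @irrational_subspaces R n d e j `<=` irrational_subspaces d l j.
Proof.
move=> l0 le en A [dA iA]; split=> // C rC.
have [c _ /(_ C rC)[B [rB CB _]]] := going_up R l0 le en.
by apply: leq_ltn_trans (iA _ rB); apply/dimvS/capvS.
Qed.

Lemma infinite_approximants A d e j l (b b' : R) : (0 < l)%N -> (l <= e)%N -> (e < n)%N ->
  (0 < j)%N -> (j <= l)%N -> (j <= d)%N -> irrational_subspaces d e j A ->
  0 < b' -> b' * ((n - e)%:R / (n - l)%:R) < b ->
  infinite_set (approximants A l j b) -> infinite_set (approximants A e j b').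
Proof.
move=> l0 le en j0 jl jd [dA iA] b'0 bb infS finS.
have e0 : (0 < e)%N by apply: leq_trans le.
set a := _ / _ in bb.
have a0 : 0 <= a by rewrite divr_ge0.
have b0 : 0 < b by apply: le_lt_trans bb; rewrite mulr_ge0// ltW.
(* Irrationality makes each of the supposedly finitely many values positive. *)
have [m m0 mS] : exists2 m : R, 0 < m & forall B, approximants A e j b' B -> m <= psi_ j A B.
  apply: finite_positive_lower_bound finS _ => B [rB _].
  apply: (is_psi_gt0 j0 (iA _ rB)); apply: psi_P; first by rewrite dA.
  by rewrite rB.2 (leq_trans jl).
have [c c0 up] := going_up R l0 le en.
(* Height above [h1] forces [H(C)^(-b) < m]; height above [h2] lets [H(C)^(b - b'a)] absorb the
   constant [c^b']. *)
pose h1 := m^-1 `^ b^-1; pose h2 := (c `^ b') `^ (b - b' * a)^-1.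
(* Otherwise all approximants of dimension [l] would have bounded height, and there would be
   finitely many. *)
have [C [[rC psiC] hC]] : exists C, approximants A l j b C /\ Num.max h1 h2 < height C.
  apply: contrapT => H; apply: infS.
  have fin := @finite_height_le R n l (Num.max h1 h2) l0.
  apply: sub_finite_set fin => C SC.
  by split; [case: SC|rewrite leNgt; apply/negP => hC; apply: H; exists C].
move: hC; rewrite gt_max => /andP[hC1 hC2].
have [B [rB CB hB]] := up _ rC; rewrite -/a in hB.
have H0 : 0 < height C by rewrite (lt_le_trans ltr01)// (height_ge1 l0 rC).
have HB0 : 0 < height B by rewrite (lt_le_trans ltr01)// (height_ge1 e0 rB).
have psiBC : psi_ j A B <= (height C `^ b)^-1.
  rewrite -powRN; apply: le_trans psiC; apply: psi_antitone => //; first by rewrite dA.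
  by rewrite rC.2.
have hBC : height B `^ b' <= height C `^ b.
  apply: (@le_trans _ _ ((c * height C `^ a) `^ b')).
    by rewrite ge0_ler_powR ?nnegrE ?mulr_ge0 ?powR_ge0// ltW.
  have -> : b = (b - b' * a) + a * b' by ring.
  rewrite powRM ?powR_ge0 ?(ltW c0)// -powRrM powRD; last by rewrite (gt_eqF H0) implybT.
  rewrite ler_wpM2r ?powR_ge0//.
  have d0 : 0 < b - b' * a by rewrite subr_gt0.
  have -> : c `^ b' = h2 `^ (b - b' * a).
    by rewrite /h2 -powRrM mulVf ?gt_eqF// powRr1 ?powR_ge0.
  by rewrite ge0_ler_powR ?nnegrE ?powR_ge0 ?(ltW H0) ?(ltW hC2) ?(ltW d0).
have SB : approximants A e j b' B.
  by split=> //; apply: le_trans psiBC _; rewrite powRN lef_pV2 ?posrE ?powR_gt0.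
have := le_trans (mS _ SB) psiBC; apply/negP; rewrite -ltNge invf_plt ?posrE ?powR_gt0//.
have -> : m^-1 = h1 `^ b by rewrite /h1 -powRrM mulVf ?gt_eqF// powRr1 ?invr_ge0 ?ltW.
by rewrite gt0_ltr_powR ?nnegrE ?powR_ge0 ?(ltW H0).
Qed.

Lemma mu_ge0 A e j : (0 <= mu A e j)%E.
Proof. by rewrite /mu le_max lexx. Qed.

Lemma mu_transfer A d e j l : (0 < l)%N -> (l <= e)%N -> (e < n)%N ->
  (0 < j)%N -> (j <= l)%N -> (j <= d)%N -> irrational_subspaces d e j A ->
  (((n%:R - l%:R) / (n%:R - e%:R) : R)%:E * mu A l j <= mu A e j)%E.
Proof.
move=> l0 le en j0 jl jd iA; rewrite -!natrB ?(ltnW en) ?(leq_trans le (ltnW en))//.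
have ne0 : 0 < (n - e)%:R :> R by rewrite ltr0n subn_gt0.
have nl0 : 0 < (n - l)%:R :> R by rewrite ltr0n subn_gt0 (leq_ltn_trans le).
set g := _ / _; have g0 : 0 < g by rewrite divr_gt0.
rewrite -lee_pdivlMl// {1}/mu ge_max mule_ge0 ?mu_ge0 ?lee_fin ?invr_ge0 ?(ltW g0)//=.
apply: ge_ereal_sup => _ [b [b0 infb] <-].
rewrite lee_pdivlMl// -EFinM leNgt; apply/negP => mub.
(* [mu A e j] is finite, being nonnegative and less than the real number [g * b]. *)
have := mu_ge0 A e j; have mufin : mu A e j \is a fin_num.
  by rewrite ge0_fin_numE ?mu_ge0// (lt_trans mub) ?ltry.
rewrite -(fineK mufin) lte_fin in mub *; rewrite lee_fin.
set r := fine _ in mub * => r0.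
(* The midpoint lies above the exponent [r], yet below [g * b], so that [infinite_approximants]
   makes it one of the exponents counted by [mu A e j]. *)
pose b' := (r + g * b) / 2.
have rb' : r < b' by rewrite /b' midf_lt.
have b'0 : 0 < b' by apply: le_lt_trans rb'.
have : (b'%:E <= mu A e j)%E.
  rewrite /mu le_max; apply/orP; right; apply: ereal_sup_ubound; exists b' => //; split=> //.
  apply: (infinite_approximants l0 le en j0 jl jd iA b'0 _ infb).
  have -> : (n - e)%:R / (n - l)%:R = g^-1 by rewrite invf_div.
  by rewrite ltr_pdivrMr// mulrC midf_lt.
by rewrite -(fineK mufin) lee_fin leNgt rb'.
Qed.
End Transference.

Theorem proposition1p1 (R : realType) (n d e j l : nat)
    (hn : (2 <= n)%N) (hd : (1 <= d)%N) (he : (1 <= e)%N)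
    (hj : (1 <= j)%N) (hl : (1 <= l)%N)
    (hde : (d + e <= n)%N) (hjl : (j <= l)%N) (hle : (l <= e)%N)
    (hjd : (j <= d)%N) :
  (((n%:R - l%:R) / (n%:R - e%:R) : R)%:E * mu_ring R n d l j
     <= mu_ring R n d e j)%E.
Proof.
have en : (e < n)%N by apply: leq_trans hde; rewrite -[X in (X < _)%N]add0n ltn_add2r.
apply/ereal_infP => _ [A iA <-].
apply: le_trans (mu_transfer hl hle en hj hjl hjd iA).
apply: lee_wpmul2l.
  by rewrite lee_fin divr_ge0// subr_ge0 ler_nat ltnW// (leq_ltn_trans hle).
by apply: ereal_inf_lbound; exists A => //; exact: irrational_antitone hle en _ iA.
Qed.
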